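(* Let $X$ be a finite homologically admissible poset and let $\mathcal{M}$ be a Morse–Smale matching on $X$. Then $$\mathrm{hccat}(X)\ \le\ \sum_{\text{basic sets }\Lambda_i}\mathrm{hccat}(\Lambda_i).$$ In particular, given a Morse matching $\mathcal{M}$ on $X$, $\mathrm{hccat}(X)$ is a lower bound for the number of critical elements of $\mathcal{M}$.
   Context: Finite posets (and their subposets) are regarded as finite $T_0$-spaces whose open sets are the down-sets. For $x\in X$, $U_x=\{y: y\le x\}$ and $\widehat U_x=\{y: y<x\}$. $x\prec y$ means $x<y$ with no element strictly between. $X$ is homologically admissible if for all $w\prec x$ in $X$ the subposet $\widehat U_x\setminus\{w\}$ is acyclic (has the integral singular homology of a point; the empty set is not acyclic). Such a poset is graded: for each $x$ all maximal chains of $U_x$ have the same length, the degree of $x$. A matching on $X$ is a set $\mathcal{M}\subset X\times X$ such that $(x,y)\in\mathcal{M}$ implies $x\prec y$, and each element of $X$ belongs to at most one pair of $\mathcal{M}$. An element in no pair of $\mathcal{M}$ is critical. An $\mathcal{M}$-path of index $p$ is a sequence $x_0\prec y_0\succ x_1\prec\cdots\prec y_{r-1}\succ x_r$, $r\ge1$, with all $x_i$ of degree $p$ and all $y_i$ of degree $p+1$, $(x_i,y_i)\in\mathcal{M}$ and $x_i\ne x_{i+1}$ for $0\le i\le r-1$. An $\mathcal{M}$-cycle is an $\mathcal{M}$-path with $x_0=x_r$; its elements are all the $x_i$ and $y_i$. It is prime if it is not the $n$-fold concatenation of an $\mathcal{M}$-cycle with itself for any $n>1$. Two $\mathcal{M}$-cycles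 are equivalent if one is obtained from the other by changing the starting point; an equivalence class is a closed $\mathcal{M}$-orbit, prime if its representatives are. The chain recurrent set $\mathcal{R}$ is the set of elements that are critical or belong to some $\mathcal{M}$-cycle. On $\mathcal{R}$, a critical element is equivalent only to itself, and distinct elements are equivalent if some $\mathcal{M}$-cycle contains both; the equivalence classes $\Lambda_i$ are the basic sets, viewed as subposets of $X$. $\mathcal{M}$ is a Morse–Smale matching if $\mathcal{R}$ consists only of critical points and pairwise disjoint prime closed $\mathcal{M}$-orbits (distinct prime closed $\mathcal{M}$-orbits have no element in common). $\mathcal{M}$ is a Morse matching if it has no $\mathcal{M}$-cycles (equivalently, the directed graph obtained from the Hasse diagram of $X$ by reversing the orientation of the edges not in $\mathcal{M}$ is acyclic). For a free chain complex $C_*$ of abelian groups, $\mathrm{rank}(C_* )=\sum_p\mathrm{rank}(C_p)$, and the homological chain category $\mathrm{hccat}(C_* )$ is the infimum of $\mathrm{rank}(B_* )$ over all bounded subcomplexes $B_*$ of $C_*$ such that the inclusion $B_*\hookrightarrow C_*$ is a quasi-isomorphism. For a topological space $Y$, $\mathrm{hccat}(Y)=\mathrm{hccat}(S_*(Y))$, where $S_*(Y)$ is the integral singular chain complex. *)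

(* Defs.v *)
From HB Require Import structures.
From mathcomp Require Import all_boot all_order all_algebra.
From mathcomp Require Import all_classical all_reals all_analysis.
From mathcomp Require Import zify.
From mathcomp Require Import generic_quotient ring_quotient.
From mathcomp.multinomials Require Import freeg.

Set Implicit Arguments.
Unset Strict Implicit.
Unset Printing Implicit Defensive.

Import Order.TTheory GRing.Theory Num.Theory.
Import numFieldNormedType.Exports.
Local Open Scope ring_scope.
Local Open Scope quotient_scope.
Local Notation lift := fintype.lift.

(* Chain complexes of abelian groups concentrated in degrees >= 0 (which then
   also holds for all their subcomplexes); [bd C p] is the differential
   C_{p+1} -> C_p, and the differential out of degree 0 is zero. *)
Record chain_complex := ChainComplex {
  chain :> nat -> zmodType;
  bd : forall p, {additive chain p.+1 -> chain p};
  bdK : forall p (c : chain p.+2), bd p (bd p.+1 c) = 0 }.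

Section Homology.
Variables (C : chain_complex) (p : nat).

Definition cycle_pred : {pred C p} :=
  match p return pred (C p) with
  | 0 => fun=> true
  | q.+1 => fun c => bd C q c == 0
  end.

Lemma cycle_pred_closed : zmod_closed cycle_pred.
Proof.
rewrite /cycle_pred; case: p => [|q]; first by split.
split=> [|x y]; rewrite !unfold_in ?raddf0 ?eqxx // => /eqP hx /eqP hy.
by rewrite raddfB /= hx hy subr0.
Qed.

HB.instance Definition _ :=
  GRing.isZmodClosed.Build (C p) cycle_pred cycle_pred_closed.

Definition cycles : Type := {c : C p | c \in cycle_pred}.
HB.instance Definition _ := SubChoice.on cycles.
HB.instance Definition _ := [SubChoice_isSubZmodule of cycles by <:].

Definition boundary_pred : {pred cycles} :=
  fun z => `[< exists c : C p.+1, bd C p c = val z >].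

Lemma boundary_pred_closed : zmod_closed boundary_pred.
Proof.
split=> [|x y].
  by rewrite unfold_in; apply/asboolP; exists 0; rewrite !raddf0.
rewrite !unfold_in => /asboolP[a ha] /asboolP[b hb].
by apply/asboolP; exists (a - b); rewrite !raddfB /= ha hb.
Qed.

HB.instance Definition _ :=
  GRing.isZmodClosed.Build cycles boundary_pred boundary_pred_closed.

Definition homology : Type := Quotient.quot boundary_pred.
HB.instance Definition _ := GRing.Zmodule.on homology.
HB.instance Definition _ := Quotient.on homology.

End Homology.

Arguments cycle_pred : clear implicits.
Arguments boundary_pred : clear implicits.

Record chain_map (C D : chain_complex) := ChainMap {
  cmap :> forall p, {additive C p -> D p};
  cmap_bd : forall p (c : C p.+1), cmap p (bd C p c) = bd D p (cmap p.+1 c) }.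

Section InducedMap.
Variables (C D : chain_complex) (f : chain_map C D) (p : nat).

Lemma cmap_cycle (z : cycles C p) : f p (val z) \in cycle_pred D p.
Proof.
case: z => z /=; rewrite !unfold_in /cycle_pred.
case: p z => [|q] // z /eqP hz; apply/eqP.
by rewrite -cmap_bd hz raddf0.
Qed.

Definition cycle_map (z : cycles C p) : cycles D p := exist _ (f p (val z)) (cmap_cycle z).

Definition homology_map (h : homology C p) : homology D p :=
  \pi_(homology D p) (cycle_map (repr h)).

Lemma homology_mapE (z : cycles C p) :
  homology_map (\pi_(homology C p) z) = \pi_(homology D p) (cycle_map z).
Proof.
apply/eqP; rewrite /homology_map -Quotient.idealrBE.
have : (repr (\pi_(homology C p) z) - z) \in boundary_pred C p.
  by rewrite Quotient.idealrBE reprK.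
rewrite !unfold_in => /asboolP[c hc]; apply/asboolP.
by exists (f p.+1 c); rewrite -cmap_bd hc !raddfB.
Qed.

End InducedMap.

Definition quasi_iso (C D : chain_complex) (f : chain_map C D) : Prop :=
  forall p, bijective (homology_map f (p := p)).

Record subcomplex (C : chain_complex) := Subcomplex {
  sub_pred : forall p, {pred C p};
  sub_closed : forall p, zmod_closed (@sub_pred p);
  sub_bd : forall p (c : C p.+1), c \in @sub_pred p.+1 -> bd C p c \in @sub_pred p }.
Arguments sub_pred {C} s p _.
Arguments sub_closed {C} s p.

Section SubcomplexComplex.
Variables (C : chain_complex) (B : subcomplex C).

HB.instance Definition _ p :=
  GRing.isZmodClosed.Build (C p) (sub_pred B p) (sub_closed B p).

Definition sub_chain p : Type := {c : C p | c \in sub_pred B p}.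
HB.instance Definition _ p := SubChoice.on (sub_chain p).
HB.instance Definition _ p := [SubChoice_isSubZmodule of sub_chain p by <:].

Definition sub_bd_fun p (c : sub_chain p.+1) : sub_chain p :=
  exist _ (bd C p (val c)) (sub_bd (valP c)).

Lemma sub_bd_additive p : zmod_morphism (@sub_bd_fun p).
Proof. by move=> x y; apply: val_inj; rewrite /= !raddfB. Qed.

HB.instance Definition _ p :=
  GRing.isZmodMorphism.Build _ _ (@sub_bd_fun p) (@sub_bd_additive p).

Lemma sub_bdK p (c : sub_chain p.+2) : sub_bd_fun (sub_bd_fun c) = 0.
Proof. by apply: val_inj; rewrite /= bdK. Qed.

Definition complex_of_sub : chain_complex :=
  @ChainComplex (fun p => sub_chain p : zmodType)
    (fun p => @sub_bd_fun p : {additive _ -> _}) sub_bdK.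

Definition inclusion : chain_map complex_of_sub C :=
  @ChainMap complex_of_sub C
    (fun p => (val : sub_chain p -> C p) : {additive _ -> _})
    (fun p c => erefl).

Definition bounded_sub : Prop :=
  exists N, forall p (c : C p), (N <= p)%N -> c \in sub_pred B p -> c = 0.

End SubcomplexComplex.

(* The rank of a free abelian group: the number of elements of a Z-basis, +oo
   when no basis is finite. It is only used on subgroups of free abelian
   groups, which are free. *)
Definition is_basis (A : zmodType) n (b : 'I_n -> A) : Prop :=
  bijective (fun k : {ffun 'I_n -> int} => \sum_i b i *~ k i).

Definition rank (R : realType) (A : zmodType) : \bar R :=
  ereal_inf [set (n%:R)%:E | n in
    [set n : nat | exists b : 'I_n -> A, is_basis b]]%classic.

Definition rank_complex (R : realType) (C : chain_complex) : \bar R :=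
  (\sum_(0 <= p <oo) rank R (C p))%E.

Definition hccat_complex (R : realType) (C : chain_complex) : \bar R :=
  ereal_inf [set rank_complex R (complex_of_sub B) | B in
    [set B : subcomplex C | bounded_sub B /\ quasi_iso (inclusion B)]]%classic.

Section Singular.
Variables (R : realType) (Y : topologicalType).

Definition std_simplex n : set 'rV[R]_n.+1 :=
  [set t | (forall i, 0 <= t ord0 i) /\ \sum_i t ord0 i = 1]%classic.
Arguments std_simplex : clear implicits.

Definition face_row n (i : 'I_n.+2) (t : 'rV[R]_n.+1) : 'rV[R]_n.+2 :=
  \row_j oapp (t ord0) 0 (unlift i j).

Lemma face_row_simplex n (i : 'I_n.+2) (t : std_simplex n) :
  face_row i (val t) \in std_simplex n.+1.
Proof.
case: t => t /= /set_mem[t0 t1]; apply/mem_set; split=> [j|].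
  by rewrite mxE; case: (unlift i j).
rewrite (bigD1 i) //= mxE unlift_none /= add0r -t1.
rewrite (reindex_omap (lift i) (unlift i)); last first.
  by move=> j; rewrite eq_sym => /unlift_some[k -> ->].
apply: eq_big => [k|k _]; first by rewrite liftK eqxx eq_sym neq_lift.
by rewrite mxE liftK.
Qed.

Definition face n (i : 'I_n.+2) (t : std_simplex n) : std_simplex n.+1 :=
  exist _ (face_row i (val t)) (face_row_simplex i t).

Lemma face_continuous n (i : 'I_n.+2) : continuous (@face n i).
Proof.
apply: continuous_comp_initial => t A [P nP PA].
suff : \forall u \near t, forall k j, P k j (face_row i (val u) k j).
  by apply: filterS => u; exact: PA.
have FF : Filter (nbhs t) by exact: nbhs_filter.
apply: (@filter_forall _ _ _ _ FF) => k.
apply: (@filter_forall _ _ _ _ FF) => j.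
have := nP k j; rewrite /face_row /= !mxE.
case e: (unlift i j) => [l|] /= Pkj; last first.
  by apply: nearW => u; rewrite mxE e; exact: nbhs_singleton Pkj.
have ct : {for t, continuous
    ((fun M : 'rV[R]_n.+1 => M ord0 l) \o (val : std_simplex n -> 'rV[R]_n.+1))}.
  apply: continuous_comp; last exact: coord_continuous.
  exact: initial_continuous.
have := ct _ Pkj; apply: (@filterS _ _ FF) => u /=.
by rewrite mxE e ord1.
Qed.

Definition sing n := continuousType (std_simplex n) Y.

Definition sing_face n (i : 'I_n.+2) (s : sing n.+1) : sing n :=
  s \o mkcts (@face_continuous n i).

Definition sing_chain n := {freeg (sing n) / int}.

Definition sing_bd n : sing_chain n.+1 -> sing_chain n :=
  fglift (fun s => \sum_(i < n.+2) (-1) ^+ i *: << sing_face i s >>).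

Lemma sing_bd_additive n : zmod_morphism (@sing_bd n).
Proof. exact: lift_is_additive. Qed.

HB.instance Definition _ n :=
  GRing.isZmodMorphism.Build _ _ (@sing_bd n) (@sing_bd_additive n).

Lemma sing_bdZ n (k : int) (c : sing_chain n.+1) :
  sing_bd (k *: c) = k *: sing_bd c.
Proof. by rewrite -[k]intz !scaler_int raddfMz. Qed.

Lemma sing_bdU n (s : sing n.+1) :
  sing_bd << s >> = \sum_(i < n.+2) (-1) ^+ i *: << sing_face i s >>.
Proof. by rewrite /sing_bd liftU scale1r. Qed.

(* The two ways of omitting the vertices i and [lift i j], with opposite signs
   in the square of the differential, are exchanged by this involution. *)
Definition face_swap n (u : 'I_n.+3 * 'I_n.+2) : 'I_n.+3 * 'I_n.+2 :=
  (lift u.1 u.2, odflt ord0 (unlift (lift u.1 u.2) u.1)).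

Lemma face_swapP n (u : 'I_n.+3 * 'I_n.+2) :
  lift (face_swap u).1 (face_swap u).2 = u.1.
Proof.
rewrite /face_swap /=; have := neq_lift u.1 u.2; rewrite eq_sym.
by case/unlift_some=> k e ->.
Qed.

Lemma face_swapK n : involutive (@face_swap n).
Proof.
move=> u; rewrite /face_swap face_swapP /= liftK /=.
by case: u.
Qed.

Lemma face_row_swap n (i b : 'I_n.+3) (j k : 'I_n.+2) (t : 'rV[R]_n.+1) :
  b = lift i j -> lift b k = i ->
  face_row i (face_row j t) = face_row b (face_row k t).
Proof.
move=> eb ei; apply/rowP => m /=; rewrite !mxE.
case: (unliftP i m) => [m1|] em /=; case: (unliftP b m) => [m2|] em' /=;
  rewrite ?mxE //.
- case: (unliftP j m1) => [m3|] e3 /=; case: (unliftP k m2) => [m4|] e4 //=.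
  + suff -> : m3 = m4 by [].
    apply: val_inj => /=.
    move: (congr1 val em) (congr1 val em') (congr1 val ei) (congr1 val eb).
    move: (congr1 val e3) (congr1 val e4); rewrite /= /bump; lia.
  + by have := neq_lift i m1; rewrite -em em' e4 ei eqxx.
  + by have := neq_lift b m2; rewrite -em' em e3 -eb eqxx.
- case: (unliftP j m1) => [m3|] e3 //=.
  by have := neq_lift j m3; rewrite -e3 -(inj_eq (@lift_inj _ i)) -eb -em em' eqxx.
- case: (unliftP k m2) => [m4|] e4 //=.
  by have := neq_lift k m4; rewrite -e4 -(inj_eq (@lift_inj _ b)) ei -em' em eqxx.
Qed.

Lemma sing_face_swap n (s : sing n.+2) (u : 'I_n.+3 * 'I_n.+2) :
  sing_face u.2 (sing_face u.1 s) =
  sing_face (face_swap u).2 (sing_face (face_swap u).1 s).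
Proof.
apply/continuousEP => t; congr (s _); apply: val_inj.
by apply: face_row_swap => //; exact: face_swapP.
Qed.

Lemma face_swap_lt n (u : 'I_n.+3 * 'I_n.+2) :
  ((face_swap u).2 < (face_swap u).1)%N = ~~ (u.2 < u.1)%N.
Proof.
have /(congr1 val) /= := face_swapP u.
have /(congr1 val) /= : (face_swap u).1 = lift u.1 u.2 by [].
by rewrite /bump; lia.
Qed.

Lemma face_swap_sum n (u : 'I_n.+3 * 'I_n.+2) : (u.2 < u.1)%N ->
  ((face_swap u).1 + (face_swap u).2).+1 = (u.1 + u.2)%N.
Proof.
have /(congr1 val) /= := face_swapP u.
have /(congr1 val) /= : (face_swap u).1 = lift u.1 u.2 by [].
by rewrite /bump; lia.
Qed.

Lemma sing_bdK n (c : sing_chain n.+2) : sing_bd (sing_bd c) = 0.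
Proof.
rewrite -[c]freeg_sumE !raddf_sum /= big1 // => s _.
have -> : << coeff s c *g s >> = coeff s c *: << s >> :> sing_chain _.
  by rewrite -[coeff s c]intz scaler_int freegU_mulz intz.
rewrite !sing_bdZ sing_bdU raddf_sum /=.
under eq_bigr => i _ do rewrite sing_bdZ sing_bdU scaler_sumr.
rewrite pair_bigA /= (bigID (fun u : 'I_n.+3 * 'I_n.+2 => u.2 < u.1)%N) /=.
rewrite [X in _ + X](reindex_inj (inv_inj (@face_swapK n))) /=.
rewrite [X in _ + X](eq_bigl (fun u : 'I_n.+3 * 'I_n.+2 => u.2 < u.1)%N); last first.
  by move=> u; rewrite (face_swap_lt u) negbK.
rewrite -big_split /= big1 ?scaler0 // => u hu.
rewrite -sing_face_swap !scalerA -scalerDl -!exprD -(face_swap_sum hu).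
by rewrite exprS mulN1r addNr scale0r.
Qed.

Definition singular_complex : chain_complex :=
  @ChainComplex (fun n => sing_chain n : zmodType)
    (fun n => @sing_bd n : {additive _ -> _}) sing_bdK.

End Singular.

Definition hccat (R : realType) (Y : topologicalType) : \bar R :=
  hccat_complex R (singular_complex R Y).

Definition acyclic (R : realType) (Y : topologicalType) : Prop :=
  forall p, exists f : {additive homology (singular_complex R Y) p ->
      homology (singular_complex R (discrete_topology unit)) p}, bijective f.

(* A poset as a topological space: the open sets are the down-sets. *)
Definition poset_space d (P : porderType d) : Type := P.

Section PosetSpace.
Context d (P : porderType d).

HB.instance Definition _ := Choice.on (poset_space P).

Definition down_set (U : set (poset_space P)) : Prop :=
  forall x y : P, (y <= x)%O -> U x -> U y.

Lemma down_setT : down_set setT. Proof. by []. Qed.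

Lemma down_setI : setI_closed down_set.
Proof. by move=> U V hU hV x y yx [/(hU _ _ yx) ? /(hV _ _ yx)]. Qed.

Lemma down_set_bigU (I : Type) (f : I -> set (poset_space P)) :
  (forall i, down_set (f i)) -> down_set (\bigcup_i f i)%classic.
Proof. by move=> hf x y yx [i _ fx]; exists i => //; exact: hf yx fx. Qed.

HB.instance Definition _ := isOpenTopological.Build (poset_space P)
  down_setT down_setI down_set_bigU.

End PosetSpace.

Section Subposet.
Context d (X : finPOrderType d).

Definition subposet (A : {set X}) : Type := {x : X | x \in A}.
HB.instance Definition _ A := SubChoice.on (subposet A).
HB.instance Definition _ A := Finite.on (subposet A).
HB.instance Definition _ A :=
  [SubChoice_isSubPOrder of subposet A by <: with d].

End Subposet.

Section Matchings.
Context d (X : finPOrderType d).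
Implicit Types (x y z w : X) (c : seq (X * X)).

Definition covers w x : bool :=
  (w < x)%O && [forall z, ~~ ((w < z)%O && (z < x)%O)].

Definition down x : {set X} := [set y | (y <= x)%O].
Definition sdown x : {set X} := [set y | (y < x)%O].

Definition homologically_admissible (R : realType) : Prop :=
  forall w x, covers w x ->
    acyclic R (poset_space (subposet (sdown x :\ w))).

Definition chain_in (A C : {set X}) : bool :=
  (C \subset A) && [forall x in C, forall y in C, (x >=< y)%O].

(* In a homologically admissible poset all the maximal chains of [down x] have
   the same length, so the maximum is taken over equal values. *)
Definition degree x : nat :=
  \max_(C : {set X} | maxset (chain_in (down x)) C) #|C|.-1.

Variable M : {set X * X}.

Definition is_matching : Prop :=
  (forall u, u \in M -> covers u.1 u.2) /\
  (forall x u v, u \in M -> v \in M ->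
     x \in [:: u.1; u.2] -> x \in [:: v.1; v.2] -> u = v).

Definition critical : {set X} :=
  [set x | [forall u in M, x \notin [:: u.1; u.2]]].

(* The M-path x_0 < y_0 > x_1 < ... < y_{r-1} > x_r is encoded by the sequence
   (x_0, y_0), ..., (x_{r-1}, y_{r-1}) together with its end point x_r. *)
Definition path_step (u : X * X) x : bool :=
  [&& u \in M, covers u.1 u.2, covers x u.2 & u.1 != x].

Definition is_path p c x : bool :=
  [&& c != [::],
      all (fun u => (degree u.1 == p) && (degree u.2 == p.+1)) c,
      degree x == p
    & all2 path_step c (rcons (behead (unzip1 c)) x)].

Definition is_cycle c : Prop :=
  if c is u :: _ then exists p, is_path p c u.1 else False.

Definition elements c : seq X := unzip1 c ++ unzip2 c.

Definition prime_cycle c : Prop :=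
  is_cycle c /\
  ~ (exists n c', [/\ (1 < n)%N, is_cycle c' & c = flatten (nseq n c')]).

Definition same_orbit c c' : Prop := exists k, c' = rot k c.

Definition chain_recurrent : {set X} :=
  [set x | (x \in critical) ||
           `[< exists2 c, is_cycle c & x \in elements c >]].

Definition basic_rel x y : bool :=
  (x == y) ||
  `[< exists c, [/\ is_cycle c, x \in elements c & y \in elements c] >].

Definition basic_sets : {set {set X}} :=
  equivalence_partition basic_rel chain_recurrent.

Definition morse_smale : Prop :=
  (forall x, x \in chain_recurrent -> x \in critical \/
     exists2 c, prime_cycle c & x \in elements c) /\
  (forall c c', prime_cycle c -> prime_cycle c' -> ~ same_orbit c c' ->
     forall x, ~ (x \in elements c /\ x \in elements c')).

Definition morse : Prop := forall c, ~ is_cycle c.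

End Matchings.

(* Main.v *)
Require Import Defs.
From HB Require Import structures.
From mathcomp Require Import all_boot all_order all_algebra.
From mathcomp Require Import all_classical all_reals all_analysis.
From mathcomp Require Import zify.
From mathcomp Require Import generic_quotient ring_quotient.
From mathcomp.multinomials Require Import freeg.

(* All chains live in S_*(X), and homology is handled through pairs of subcomplexes
   B < E by the condition H_*(E, B) = 0, stated elementwise ([rel_acyclic]), or
   H_*(E, B) = Z in a single degree ([rel_cell]).  If w is covered by x, the down-set
   sdown x is the union of the open sets sdown x :\ w, which is acyclic, and down w,
   which is a cone; excision (barycentric subdivision) then shows by induction that
   (down x, sdown x) is a cell, of dimension the degree of x.

   Given a Morse matching, X is exhausted by down-sets by adding either a critical
   element x, which attaches a cell along sdown x and costs one generator, or a matched
   pair w < x at once, which attaches a cone along the acyclic set sdown x :\ w and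
   costs nothing.  If neither were possible, the elements of minimal degree left over
   would contain an M-cycle.  This yields a subcomplex of S_*(X) with one generator per
   critical element.

   A Morse-Smale matching becomes a Morse matching by removing one pair in each closed
   orbit, which creates two critical elements there.  A basic set that is an orbit has
   nontrivial homology in degrees 0 and 1, hence hccat at least 2. *)

Set Implicit Arguments.
Unset Strict Implicit.
Unset Printing Implicit Defensive.

Import Order.TTheory GRing.Theory Num.Theory.
Import numFieldNormedType.Exports.
Local Open Scope ring_scope.
Local Notation lift := fintype.lift.
(* [down] is also a name of the library of real numbers. *)
Local Notation down := Defs.down.
Local Notation "c \is_in E" := (c \in sub_pred E _) (at level 70).

(** * Relative homology of subcomplexes *)

(** The category [hccat] asks for a subcomplex of the singular complex itself, so a model up to
    chain equivalence is not enough. Each generator is an actual singular chain, corrected by a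
    chain of the previous stage until its boundary falls into the small subcomplex built so far.
    This is why relative homology is handled by explicit fillings rather than by quotient groups and
    exact sequences.

    Acyclicity is given as an abstract isomorphism with the homology of a point, whereas the
    arguments use augmentations. It is therefore converted into the form: some 0-chain has
    augmentation 1, and every reduced cycle bounds.

    That the poset is graded is a consequence of the homology: the dimension of a cell is unique and
    rises by one along a cover.

    The Morse-Smale bound is the Morse bound for a smaller matching. The homology of a basic set
    that contains a cycle is never computed; a nonzero class in each of the degrees 0 and 1 suffices
    against the two new critical elements. *)

Section RelativeHomology.
Variable C : chain_complex.
Implicit Types A B D E U : subcomplex C.

(** The differential made total: it is zero out of degree 0, so that relative cycle conditions read
    the same in all degrees. *)
Definition bdp p : C p -> C p.-1 :=
  match p return C p -> C p.-1 with
  | 0 => fun=> 0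
  | q.+1 => bd C q
  end.

Lemma bdp_additive p : zmod_morphism (@bdp p).
Proof. by case: p => [|p] x y /=; rewrite ?subr0 // raddfB. Qed.

HB.instance Definition _ p :=
  GRing.isZmodMorphism.Build _ _ (@bdp p) (@bdp_additive p).

Lemma bdpK p (c : C p.+1) : bdp (bd C p c) = 0.
Proof. by case: p c => [|p] c //=; rewrite bdK. Qed.

Lemma subc0 E p : (0 : C p) \is_in E.
Proof. exact: rpred0. Qed.

Lemma subcD E p (c c' : C p) : c \is_in E -> c' \is_in E -> c + c' \is_in E.
Proof. exact: rpredD. Qed.

Lemma subcN E p (c : C p) : (- c \is_in E) = (c \is_in E).
Proof. exact: rpredN. Qed.

Lemma subcB E p (c c' : C p) : c \is_in E -> c' \is_in E -> c - c' \is_in E.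
Proof. exact: rpredB. Qed.

Lemma subcMz E p (c : C p) k : c \is_in E -> c *~ k \is_in E.
Proof. by move=> cE; exact: rpredMz. Qed.

Lemma bdp_sub E p (c : C p) : c \is_in E -> bdp c \is_in E.
Proof. case: p c => [|p] c /=; [by rewrite subc0 | exact: sub_bd]. Qed.

Local Notation sub_le B E :=
  (forall p (c : C p), c \is_in B -> c \is_in E).

(* [H_*(E, B) = 0], that is, the inclusion of B in E is a quasi-isomorphism. *)
Definition rel_acyclic B E := forall p (c : C p),
  c \is_in E -> bdp c \is_in B ->
  exists2 e : C p.+1, e \is_in E & c - bd C p e \is_in B.

(* [H_*(E, B)] is infinite cyclic, concentrated in degree n and generated by
   the class of z. *)
Definition rel_cell B E n (z : C n) :=
  [/\ z \is_in E, bdp z \is_in B,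
      forall p (c : C p), c \is_in E -> bdp c \is_in B -> p <> n ->
        exists2 e : C p.+1, e \is_in E & c - bd C p e \is_in B,
      forall c : C n, c \is_in E -> bdp c \is_in B ->
        exists k : int, exists2 e : C n.+1, e \is_in E &
          c - z *~ k - bd C n e \is_in B
    & forall (k : int) (e : C n.+1), e \is_in E ->
        z *~ k - bd C n e \is_in B -> k = 0].

Lemma rel_acyclic_refl E : rel_acyclic E E.
Proof. by move=> p c cE _; exists 0; rewrite ?subc0 // raddf0 subr0. Qed.

(** A filling in [E] moves a relative cycle into [A], where it is still a cycle modulo [B] and can
    be filled again. *)
Lemma rel_acyclic_trans B A E :
  sub_le B A -> sub_le A E -> rel_acyclic B A -> rel_acyclic A E -> rel_acyclic B E.
Proof.
move=> BA AE hBA hAE p c cE cB.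
have [e eE ceA] := hAE p c cE (BA _ _ cB).
have [|e' e'A ceB] := hBA p _ ceA; first by rewrite raddfB /= bdpK subr0.
exists (e + e'); last by rewrite raddfD /= opprD addrA.
by rewrite subcD // AE.
Qed.

Definition in_sum A U p (c : C p) :=
  exists a, exists2 u, a \is_in A /\ u \is_in U & c = a + u.

(* [A + U -> E] is a quasi-isomorphism, with D the intersection of A and U. *)
Definition excisive A U D E :=
  [/\ sub_le A E, sub_le U E,
      forall p (c : C p), c \is_in D <-> c \is_in A /\ c \is_in U
    & forall p (c : C p), c \is_in E -> in_sum A U (bdp c) ->
        exists2 e : C p.+1, e \is_in E & in_sum A U (c - bd C p e)].

Section Excision.
Variables A U D E : subcomplex C.
Hypothesis exc : excisive A U D E.

(** After splitting [c] as [a + u] up to a boundary, the boundary of [u] is that of [c] minus that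
    of [a]. It therefore lies in [A] as well as in [U], and [u] is a relative cycle of [(U, D)]. *)
Lemma excision_split p (c : C p) : c \is_in E -> bdp c \is_in A ->
  exists u, exists2 e, [/\ u \is_in U, bdp u \is_in D & e \is_in E] &
    c - u - bd C p e \is_in A.
Proof.
case: exc => AE UE hD sml cE cA.
have [|e eE [a [u [aA uU] ce]]] := sml p c cE.
  by exists (bdp c), 0; rewrite ?subc0 ?addr0.
exists u; exists e; last by rewrite addrAC ce addrK.
split=> //; apply/hD; split; last exact: bdp_sub.
have /(congr1 (@bdp p)) := ce; rewrite raddfB raddfD /= bdpK subr0 => eqc.
by rewrite -(addKr (bdp a) (bdp u)) -eqc subcD // subcN bdp_sub.
Qed.

Lemma excision_acyclic : rel_acyclic D U -> rel_acyclic A E.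
Proof.
case: (exc) => AE UE hD sml hDU p c cE cA.
have [u [e [uU uD eE] cue]] := excision_split cE cA.
have [e' e'U ueD] := hDU _ _ uU uD.
exists (e + e'); first by rewrite subcD // UE.
have -> : c - bd C p (e + e') = (c - u - bd C p e) + (u - bd C p e').
  by rewrite raddfD /= opprD addrA [in RHS](addrAC c) subrKA.
by rewrite subcD //; have /hD[] := ueD.
Qed.

Lemma excision_cell n (z : C n) : rel_cell D U z -> rel_cell A E z.
Proof.
case: (exc) => AE UE hD sml [zU zD other gen uniq]; split.
- exact: UE.
- by have /hD[] := zD.
- move=> p c cE cA pn; have [u [e [uU uD eE] cue]] := excision_split cE cA.
  have [e' e'U ueD] := other _ _ uU uD pn.
  exists (e + e'); first by rewrite subcD // UE.
  have -> : c - bd C p (e + e') = (c - u - bd C p e) + (u - bd C p e').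
    by rewrite raddfD /= opprD addrA [in RHS](addrAC c) subrKA.
  by rewrite subcD //; have /hD[] := ueD.
- move=> c cE cA; have [u [e [uU uD eE] cue]] := excision_split cE cA.
  have [k [e' e'U ueD]] := gen _ uU uD.
  exists k; exists (e + e'); first by rewrite subcD // UE.
  have -> : c - z *~ k - bd C n (e + e') =
      (c - u - bd C n e) + (u - z *~ k - bd C n e').
    rewrite raddfD /= opprD addrA -(addrA u) [in RHS](addrAC c (- u)) subrKA addrA.
    by rewrite (addrAC c).
  by rewrite subcD //; have /hD[] := ueD.
(* The boundary of [e] is a chain of [A] plus a chain of [U], so some [a + u] has the same boundary
   as [e]; then [u] is a relation on [z] inside [U], modulo [D]. *)
- move=> k e eE zeA.
  have [|f fE [a [u [aA uU] efE]]] := sml _ e eE.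
    exists (bd C n e - z *~ k), (z *~ k).
      by rewrite -opprB subcN zeA subcMz // UE.
    by rewrite /= subrK.
  have bdE : bd C n e = bd C n a + bd C n u.
    by have /(congr1 (bd C n)) := efE; rewrite raddfB raddfD /= bdK subr0.
  apply: (uniq k u uU); apply/hD; split; last first.
    by rewrite subcB ?subcMz // sub_bd.
  have -> : z *~ k - bd C n u = (z *~ k - bd C n e) + bd C n a.
    by rewrite bdE opprD addrA addrAC addrNK.
  by rewrite subcD // sub_bd.
Qed.

End Excision.

(** If the dimensions differed, the vanishing known from [y] in degree [n] would make [z] a relative
    boundary, against its infinite order. *)
Lemma rel_cell_dim B E n (z : C n) m (y : C m) :
  rel_cell B E z -> rel_cell B E y -> n = m.
Proof.
move=> [zE zB _ _ uniq] [_ _ other _ _]; apply: contrapT => nm.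
have [e eE zeB] := other _ _ zE zB nm.
have // : 1%:Z = 0 by apply: (uniq _ e); rewrite ?mulr1z.
Qed.

(** * Reduced homology, and cells obtained from acyclic complexes *)

Section Reduced.
Variable aug : {additive C 0%N -> int}.
Hypothesis aug_bd : forall c : C 1%N, aug (bd C 0 c) = 0.

Definition red_cycle p : C p -> Prop :=
  match p return C p -> Prop with
  | 0 => fun c => aug c = 0
  | q.+1 => fun c => bd C q c = 0
  end.

(** Exactness of the augmented complex. The chain of augmentation 1 excludes the zero complex, hence
    the empty space. *)
Definition red_acyclic U :=
  (exists2 d : C 0%N, d \is_in U & aug d = 1) /\
  forall p (c : C p), c \is_in U -> red_cycle c ->
    exists2 e : C p.+1, e \is_in U & bd C p e = c.

Lemma red_cycle_bd p (c : C p.+1) : red_cycle (bd C p c).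
Proof. by case: p c => [|p] c /=; rewrite ?aug_bd ?bdK. Qed.

(** A boundary lying in [D] is filled inside [D], and the difference is then a cycle of [U]. In
    degree 0, where every chain is a relative cycle, a multiple of [d] absorbs the augmentation. *)
Lemma red_acyclic_rel D U : sub_le D U ->
  red_acyclic D -> red_acyclic U -> rel_acyclic D U.
Proof.
move=> DU [[d dD augd] hD] [_ hU] [|p] c cU cD.
  have [||e eU ed] := hU _ (c - d *~ aug c).
  - by rewrite subcB ?subcMz // DU.
  - by rewrite /= raddfB raddfMz /= augd intz subrr.
  by exists e; rewrite // ed opprB addrC subrK subcMz.
have [v vD ev] := hD _ _ cD (red_cycle_bd c).
have [||e eU ee] := hU _ (c - v).
- by rewrite subcB // DU.
- by rewrite /= raddfB /= ev subrr.
by exists e; rewrite // ee opprB addrC subrK.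
Qed.

Lemma red_acyclic_cell0 B U : (forall p (c : C p), c \is_in B -> c = 0) ->
  red_acyclic U -> exists z : C 0%N, rel_cell B U z.
Proof.
move=> B0 [[d dU augd] hU]; exists d; split => //.
- by rewrite /= subc0.
- move=> [|p] // c cU cB _; have [|e eU ec] := hU _ _ cU; first exact: B0 cB.
  by exists e; rewrite // ec subrr subc0.
- move=> c cU _; have [||e eU ec] := hU _ (c - d *~ aug c).
  + by rewrite subcB ?subcMz.
  + by rewrite /= raddfB raddfMz /= augd intz subrr.
  by exists (aug c); exists e; rewrite // ec subrr subc0.
- move=> k e eU /B0 /(congr1 aug).
  by rewrite raddfB /= raddfMz aug_bd augd intz subr0 raddf0.
Qed.

(* The boundary map of the triple [D < E < U] is an isomorphism from
   [H_(p+1)(U, E)] to [H_p(E, D)], as D and U are acyclic. *)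
Lemma red_acyclic_cellS D E U n (z : C n) : sub_le D E -> sub_le E U ->
  red_acyclic D -> red_acyclic U -> rel_cell D E z ->
  exists y : C n.+1, rel_cell E U y.
Proof.
move=> DE EU hD hU [zE zD other gen uniq].
(* As [D] is acyclic, subtracting a chain of [D] turns [z] into a reduced cycle. Its filling [y] in
   [U] is the generator one degree higher. *)
have [w wD zw] : exists2 w, w \is_in D & red_cycle (z - w).
  case: hD => -[d dD augd] hD; case: n z zE zD {other gen uniq} => [|n] z zE zD.
    exists (d *~ aug z); first by rewrite subcMz.
    by rewrite /= raddfB raddfMz /= augd intz subrr.
  have [w wD ew] := hD _ _ zD (red_cycle_bd z).
  by exists w; rewrite //= raddfB /= ew subrr.
case: (hU) => -[d dU augd] hU'.
have [y yU ey] : exists2 y : C n.+1, y \is_in U & bd C n y = z - w.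
  by apply: hU' => //; rewrite subcB // EU // DE.
(* The boundary [f] is also the boundary of a chain of [D]; the difference with [c] is a cycle of
   [U], hence a boundary. *)
have close p (c : C p.+1) (f : C p) : c \is_in U -> f \is_in D ->
    bd C p c = f -> exists2 e : C p.+2, e \is_in U & c - bd C p.+1 e \is_in E.
  move=> cU fD ef; have [e eD ee] : exists2 e, e \is_in D & bd C p e = f.
    by apply: hD.2; rewrite // -ef; exact: red_cycle_bd.
  have [||g gU eg] := hU' _ (c - e).
  - by rewrite subcB // EU // DE.
  - by rewrite /= raddfB /= ef ee subrr.
  by exists g; rewrite // eg opprB addrC subrK DE.
exists y; split=> //.
- by rewrite /= ey subcB // DE.
(* In degree 0 the relative group vanishes because [d] is homologous in [U] to a chain [d'] of [D].
   In higher degrees the boundary of [c] is a relative cycle of [(E, D)], so it can be corrected by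
   a chain of [E]. *)
- move=> [|p] c cU cE pn.
    have [||e eU ee] := @hU' 0%N (c - d *~ aug c).
    - by rewrite subcB ?subcMz.
    - by rewrite /= raddfB raddfMz /= augd intz subrr.
    case: hD => -[d' d'D augd'] _.
    have [||e' e'U ee'] := @hU' 0%N (d - d').
    - by rewrite subcB // EU // DE.
    - by rewrite /= raddfB /= augd augd' subrr.
    exists (e + e' *~ aug c); first by rewrite subcD ?subcMz.
    rewrite raddfD /= raddfMz ee ee' mulrzBl subrKA opprB addrC subrK.
    by rewrite subcMz // DE.
  have [||e eE ce] := other p (bd C p c) cE.
  - by rewrite bdpK subc0.
  - by move=> pn'; apply: pn; rewrite pn'.
  have [|||g gU eg] := close p (c - e) (bd C p c - bd C p e).
  - by rewrite subcB // EU.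
  - by [].
  - by rewrite raddfB.
  exists g; first by [].
  have -> : c - bd C p.+1 g = (c - e - bd C p.+1 g) + e by rewrite addrAC subrK.
  by rewrite subcD.
- move=> c cU cE; have [|k [e eE ce]] := gen _ cE; first by rewrite bdpK subc0.
  exists k.
  have [|||g gU eg] := close n (c - y *~ k - e) (bd C n c - z *~ k - bd C n e + w *~ k).
  + by rewrite !subcB ?subcMz // EU.
  + by rewrite subcD ?subcMz.
  + rewrite !raddfB /= raddfMz ey mulrzBl opprB addrA addrAC.
    by rewrite [in RHS](addrAC _ _ (w *~ k)) (addrAC (bd C n c)).
  exists g; first by [].
  have -> : c - y *~ k - bd C n.+1 g = (c - y *~ k - e - bd C n.+1 g) + e.
    by rewrite [RHS]addrAC subrK.
  by rewrite subcD.
(* The relation on [y] is a chain of [E] with boundary [(z - w) *~ k], so it is itself a relation on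
   [z] modulo [D]. *)
- move=> k e eU yE; apply: (uniq k (y *~ k - bd C n.+1 e)) => //.
  rewrite raddfB raddfMz /= bdK subr0 ey mulrzBl opprB addrC subrK.
  by rewrite subcMz.
Qed.

End Reduced.

(** The boundary of [z] is a cycle of [A], hence homologous in [A] to a chain of [B]. This allows a
    cell to be attached to the small model [B] instead of [A]. *)
Lemma rel_cell_adjust B A E n (z : C n) : sub_le A E ->
  rel_acyclic B A -> rel_cell A E z ->
  exists2 z' : C n, rel_cell A E z' & bdp z' \is_in B.
Proof.
move=> AE hBA [zE zA other gen uniq].
have [a aA zaB] : exists2 a : C n, a \is_in A & bdp (z - a) \is_in B.
  case: n z zE zA {other gen uniq} => [|n] z zE zA.
    by exists 0; rewrite ?subc0 // raddfB subc0.
  have [||a aA zaB] := hBA n (bdp z); [by []|by rewrite bdpK subc0|].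
  by exists a; rewrite // raddfB.
exists (z - a); last by [].
split.
- by rewrite subcB // AE.
- by rewrite raddfB /= subcB // bdp_sub.
- exact: other.
- move=> c cE cA; have [k [e eE ceA]] := gen c cE cA.
  exists k; exists e => //.
  have -> : c - (z - a) *~ k - bd C n e = c - z *~ k - bd C n e + a *~ k.
    by rewrite mulrzBl opprB addrA addrAC [RHS]addrAC (addrAC c).
  by rewrite subcD // subcMz.
- move=> k e eE ceA; apply: (uniq k e) => //.
  have -> : z *~ k - bd C n e = (z - a) *~ k - bd C n e + a *~ k.
    by rewrite mulrzBl addrAC subrK.
  by rewrite subcD // subcMz.
Qed.

(** Coefficients are indexed by [nat], so that a generator added in front just shifts them; those
    from [size g] on are ignored. *)
Definition is_free_basis p (P : {pred C p}) (g : seq (C p)) :=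
  (forall c : C p, c \in P <->
     exists k : nat -> int, c = \sum_(i < size g) g`_i *~ k i) /\
  (forall k : nat -> int, \sum_(i < size g) g`_i *~ k i = 0 ->
     forall i, (i < size g)%N -> k i = 0).

Lemma is_free_basis_nil p (P : {pred C p}) :
  (forall c : C p, c \in P <-> c = 0) -> is_free_basis P [::].
Proof.
move=> P0; split=> // c; rewrite P0; split=> [->|[k]]; last by rewrite big_ord0.
by exists (fun=> 0); rewrite big_ord0.
Qed.

Lemma is_free_basis_cons p (P P' : {pred C p}) (g : seq (C p)) (z : C p) :
  is_free_basis P g ->
  (forall c, c \in P' <-> exists k : int, c - z *~ k \in P) ->
  (forall k : int, z *~ k \in P -> k = 0) ->
  is_free_basis P' (z :: g).
Proof.
move=> [gP indep] hP' zfree; split=> [c|k].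
  rewrite hP'; split=> [[k /gP[l el]]|[k ->]].
    exists (fun i => if i is j.+1 then l j else k).
    by rewrite /= big_ord_recl /= -el addrC subrK.
  exists (k 0); apply/gP; exists (fun i => k i.+1).
  by rewrite /= big_ord_recl /= addrC addKr.
rewrite /= big_ord_recl /= => /eqP; rewrite addrC addr_eq0 => /eqP e0.
have k0 : k 0 = 0.
  by apply: zfree; apply/gP; exists (fun i => - k i.+1);
     rewrite -[LHS]opprK -e0 -sumrN; apply: eq_bigr => i _; rewrite mulrNz.
case=> [|i] //; rewrite ltnS; apply: (indep (fun i => k i.+1)).
by rewrite e0 k0 mulr0z oppr0.
Qed.

(* A has the homology of a subcomplex of it that is free of rank at most K. *)
Definition presented A K :=
  exists B (g : forall p, seq (C p)),
    [/\ sub_le B A, rel_acyclic B A, forall p, is_free_basis (sub_pred B p) (g p),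
        exists N, forall p, (N <= p)%N -> g p = [::]
      & forall m, (\sum_(p < m) size (g p) <= K)%N].

Lemma presented0 A : (forall p (c : C p), c \is_in A -> c = 0) -> presented A 0.
Proof.
move=> A0; exists A, (fun=> [::]); split=> //.
- exact: rel_acyclic_refl.
- by move=> p; apply: is_free_basis_nil => c; split=> [/A0|->]; rewrite ?subc0.
- by exists 0%N.
- by move=> m; rewrite big1.
Qed.

Lemma presented_acyclic A E K :
  sub_le A E -> rel_acyclic A E -> presented A K -> presented E K.
Proof.
move=> AE hAE [B [g [BA hBA bas bnd siz]]]; exists B, g; split=> //.
  by move=> p c /BA /AE.
exact: rel_acyclic_trans hAE.
Qed.

(** * Adjoining one generator to a subcomplex *)

Section AddCell.
Variables (B : subcomplex C) (n : nat) (z : C n).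
Hypothesis zB : bdp z \is_in B.

(** The generator as a graded family, zero outside degree [n]; this spares casts between chain
    groups of provably equal degrees. *)
Let zz := dfwith (fun p => 0 : C p) n z.

Definition add_cell_pred p : {pred C p} :=
  fun c => `[< exists k : int, c - zz p *~ k \is_in B >].

Lemma add_cell_closed p : zmod_closed (@add_cell_pred p).
Proof.
split=> [|x y]; rewrite !unfold_in.
  by apply/asboolP; exists 0; rewrite subr0 subc0.
move=> /asboolP[k xk] /asboolP[l yl]; apply/asboolP; exists (k - l).
have -> : x - y - zz p *~ (k - l) = (x - zz p *~ k) - (y - zz p *~ l).
  by rewrite mulrzBr !opprB addrACA [RHS]addrACA (addrC (- y)).
exact: subcB.
Qed.

Lemma add_cell_bdz p : bdp (zz p) \is_in B.
Proof.
rewrite /zz; have [<-|np] := eqVneq n p; first by rewrite dfwithin.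
by rewrite dfwithout // raddf0 subc0.
Qed.

Lemma add_cell_bd p (c : C p.+1) :
  c \in @add_cell_pred p.+1 -> bd C p c \in @add_cell_pred p.
Proof.
rewrite !unfold_in => /asboolP[k ck]; apply/asboolP; exists 0.
rewrite subr0 -(subrK (zz p.+1 *~ k) c) raddfD /= raddfMz.
by apply: subcD; [exact: sub_bd | apply: subcMz; exact: (add_cell_bdz p.+1)].
Qed.

Definition add_cell : subcomplex C :=
  Subcomplex add_cell_closed add_cell_bd.

Lemma add_cellP p (c : C p) :
  c \is_in add_cell <-> exists k : int, c - zz p *~ k \is_in B.
Proof. by rewrite /= unfold_in; split=> /asboolP. Qed.

Lemma add_cell_in (c : C n) :
  c \is_in add_cell <-> exists k : int, c - z *~ k \is_in B.
Proof. by rewrite add_cellP /zz dfwithin. Qed.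

Lemma add_cell_out p (c : C p) : n != p ->
  c \is_in add_cell <-> c \is_in B.
Proof.
move=> np; rewrite add_cellP /zz dfwithout //; split=> [[k]|cB].
  by rewrite mul0rz subr0.
by exists 0; rewrite subr0.
Qed.

End AddCell.

(** The model of [A] receives the adjusted generator [z']. Its infinite order modulo [A] keeps the
    enlarged basis free and keeps [z'] out of the boundaries. *)
Lemma presented_cell A E K n (z : C n) :
  sub_le A E -> rel_cell A E z -> presented A K -> presented E K.+1.
Proof.
move=> AE hz [B [g [BA hBA bas [N bnd] siz]]].
have [z' [zE zA other gen uniq] zB] := rel_cell_adjust AE hBA hz.
exists (add_cell zB), (dfwith g n (z' :: g n)).
have zfree (k : int) : z' *~ k \is_in A -> k = 0.
  by move=> zkA; apply: (uniq k 0); rewrite ?subc0 // raddf0 subr0.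
have BE p (c : C p) : c \is_in B -> c \is_in add_cell zB.
  by move=> cB; apply/add_cellP; exists 0; rewrite subr0.
split.
- move=> p c; have [np|np] := eqVneq n p.
    case: p / np c => c /add_cell_in[k /BA /AE ckE].
    by rewrite -(subrK (z' *~ k) c) subcD // subcMz.
  by move/(add_cell_out _ _ np)/BA/AE.
- move=> p c cE cB'.
  (* If the boundary of [c] involves [z'] with coefficient [k], then [z' *~ k] is a boundary modulo
     [A], so [k = 0]. *)
  have cA : bdp c \is_in A.
    case: p c cE cB' => [|p] c cE; first by move=> *; exact: subc0.
    have [np|np] := eqVneq n p; last by move/(add_cell_out _ _ np)/BA.
    case: p / np c cE => c cE /add_cell_in[k /BA cA] /=.
    have k0 : k = 0.
      apply: (uniq k c) => //; rewrite -opprB subcN.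
      exact: cA.
    by move: cA; rewrite k0 subr0.
  have cB : bdp c \is_in B.
    case: p c cE cB' cA => [|p] c cE; first by move=> *; exact: subc0.
    have [np|np] := eqVneq n p; last by move/(add_cell_out _ _ np).
    case: p / np c cE => c cE /add_cell_in[k ckB] /= cA.
    have k0 : k = 0.
      apply: zfree; rewrite -(subKr (bd C n c) (z' *~ k)) subcB //.
      exact: BA.
    by move: ckB; rewrite k0 subr0.
  (* In degree [n] a multiple of [z'] has to be removed, in the other degrees that multiple is zero.
     Either way a relative cycle of [(A, B)] remains. *)
  have [k [e [eE ceA ceB]]] : exists k : int, exists e : C p.+1,
      [/\ e \is_in E, c - dfwith (fun p => 0 : C p) n z' p *~ k - bd C p e \is_in A
        & bdp (c - dfwith (fun p => 0 : C p) n z' p *~ k - bd C p e) \is_in B].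
    have [np|np] := eqVneq n p.
      case: p / np c cE cA cB cB' => c cE cA cB _; rewrite dfwithin.
      have [k [e eE ceA]] := gen c cE cA.
      exists k, e; split=> //; rewrite 2!raddfB raddfMz /= bdpK subr0.
      by rewrite subcB // subcMz.
    have [e eE ceA] := other p c cE cA (fun e => negP np (introT eqP (esym e))).
    exists 0, e; split; rewrite ?subr0 //.
    by rewrite raddfB /= bdpK subr0.
  have [f fA cefB] := hBA _ _ ceA ceB.
  exists (e + f); first by rewrite subcD // AE.
  apply/add_cellP; exists k.
  move: cefB; set z1 := dfwith _ _ _ _ *~ k => cefB.
  suff -> : c - bd C p (e + f) - z1 = c - z1 - bd C p e - bd C p f by [].
  by rewrite raddfD /= opprD addrA [LHS]addrAC (addrAC c (- bd C p e)).
- move=> p; have [np|np] := eqVneq n p.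
    case: p / np; rewrite dfwithin; apply: (is_free_basis_cons (bas n)).
      exact: add_cell_in.
    by move=> k /BA /zfree.
  rewrite dfwithout //; case: (bas p) => gB indep; split=> // c.
  by rewrite -gB; exact: add_cell_out.
- exists (maxn N n.+1) => p; rewrite geq_max => /andP[/bnd e np].
  by rewrite dfwithout // neq_ltn np.
- move=> m; apply: (@leq_trans (\sum_(p < m) (size (g p) + (p == n :> nat)))).
    apply: leq_sum => p _; have [np|np] := eqVneq n p.
      by rewrite -np dfwithin /= addn1.
    by rewrite dfwithout // leq_addr.
  rewrite big_split /= -addn1 leq_add ?siz //.
  have [nm|mn] := ltnP n m.
    rewrite (bigD1 (Ordinal nm)) //= eqxx big1 ?addn0 // => i.
    by rewrite -val_eqE /= => /negPf ->.
  by rewrite big1 // => i _; rewrite ltn_eqF // (leq_trans (ltn_ord i)).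
Qed.

Definition full_sub : subcomplex C :=
  @Subcomplex C (fun p => predT) (fun p => conj isT (fun _ _ _ _ => isT))
    (fun p c _ => isT).

End RelativeHomology.

(** * Ranks and the homological chain category *)

Section Rank.
Variables (R : realType) (A : zmodType).

Lemma rank_ge0 : (0 <= rank R A)%E.
Proof. by apply: le_ereal_inf_tmp => _ [n _ <-]; rewrite lee_fin. Qed.

Lemma rank_ge1 (a : A) : a != 0 -> (1 <= rank R A)%E.
Proof.
move=> a0; apply: le_ereal_inf_tmp => _ [[|n] [b [g fK gK]] <-]; last first.
  by rewrite lee_fin ler1n.
by move: a0; rewrite -(gK a) big_ord0 eqxx.
Qed.

Lemma rank_le n (b : 'I_n -> A) : is_basis b -> (rank R A <= (n%:R)%:E)%E.
Proof. by move=> hb; apply: ereal_inf_lbound; exists n => //; exists b. Qed.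

End Rank.

Section HomologyClasses.
Variable C : chain_complex.

Lemma homology_eqP p (z z' : cycles C p) :
  \pi_(homology C p)%qT z = \pi_(homology C p)%qT z' <->
  exists c, bd C p c = val z - val z'.
Proof.
split=> [/eqP|[c ec]].
  by rewrite -Quotient.idealrBE unfold_in => /asboolP.
by apply/eqP; rewrite -Quotient.idealrBE unfold_in; apply/asboolP; exists c.
Qed.

Lemma cycle_predE p (c : C p) : (c \in cycle_pred C p) = (bdp c == 0).
Proof. by case: p c => [|p] c; rewrite unfold_in //= eqxx. Qed.

End HomologyClasses.

Lemma inj_surj_bij (T U : Type) (f : T -> U) :
  injective f -> (forall y, exists x, f x = y) -> bijective f.
Proof.
move=> fI /choice[g gK]; exists g => // x.
by apply: fI; rewrite gK.
Qed.

Section Inclusion.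
Variable C : chain_complex.

Lemma quasi_iso_cycle (B : subcomplex C) p (c : C p) :
  quasi_iso (inclusion B) -> bdp c = 0 ->
  exists e, c - bd C p e \is_in B.
Proof.
move=> /(_ p)[g _ gK] c0.
have cZ : c \in cycle_pred C p by rewrite cycle_predE c0.
have := gK (\pi_(homology C p)%qT (exist _ c cZ : cycles C p)).
rewrite -[g _]reprK homology_mapE => /homology_eqP[e /= ee].
exists (- e); rewrite raddfN opprK ee addrC subrK.
by case: (sval (repr _)).
Qed.

Lemma rel_acyclic_quasi_iso (B : subcomplex C) :
  rel_acyclic B (full_sub C) -> quasi_iso (inclusion B).
Proof.
move=> acy p; apply: inj_surj_bij => [h h'|h].
  rewrite -[h]reprK -[h']reprK !homology_mapE => /homology_eqP[c /= ec].
  have cB : bdp c \is_in B.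
    rewrite [bdp c]ec; apply: subcB; by case: (sval (repr _)).
  have [e _ ceB] := acy _ c isT cB.
  apply/homology_eqP; exists (exist _ (c - bd C p.+1 e) ceB).
  by apply: val_inj; rewrite /= raddfB /= bdK subr0 ec.
rewrite -[h]reprK; set z := repr h.
have zc : bdp (val z) = 0 by apply/eqP; rewrite -cycle_predE; exact: valP.
have [e _ zeB] := acy _ (val z) isT (eq_ind_r (fun x => x \is_in B) (subc0 B _) zc).
pose b : complex_of_sub B p := exist _ (val z - bd C p e) zeB.
have bZ : b \in cycle_pred (complex_of_sub B) p.
  rewrite cycle_predE; apply/eqP; case: p h z zc e zeB @b => [|p] h z zc e zeB b //.
  by apply: val_inj; rewrite /= raddfB /= bdK subr0.
exists (\pi_(homology (complex_of_sub B) p)%qT (exist _ b bZ : cycles _ p)).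
rewrite homology_mapE; apply/homology_eqP; exists (- e).
by rewrite /= raddfN addrAC subrr add0r.
Qed.

End Inclusion.

Section HcCat.
Variables (R : realType) (C : chain_complex).

Lemma rank_sub_free (B : subcomplex C) p (g : seq (C p)) :
  is_free_basis (sub_pred B p) g ->
  (rank R (complex_of_sub B p) <= ((size g)%:R)%:E)%E.
Proof.
move=> [gB indep].
have gin (i : 'I_(size g)) : g`_i \is_in B.
  apply/gB; exists (fun j => (j == i :> nat)%:R).
  rewrite (bigD1 i) //= eqxx mulr1z big1 ?addr0 // => j.
  by rewrite -val_eqE /= => /negPf ->.
pose b (i : 'I_(size g)) : complex_of_sub B p := exist _ g`_i (gin i).
have valb (k : 'I_(size g) -> int) :
    val (\sum_i b i *~ k i) = \sum_(i < size g) g`_i *~ k i.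
  elim/big_ind2: _ => // [x _ y _ <- <- //|i _].
  exact: (raddfMz (val : sub_chain B p -> C p)).
apply: (@rank_le _ _ _ b); apply: inj_surj_bij => [k l ekl|[c cB]].
  have {ekl} : \sum_(i < size g) b i *~ (k i - l i) = 0.
    by under eq_bigr do rewrite mulrzBr; rewrite sumrB; apply/eqP; rewrite subr_eq0; apply/eqP.
  move=> /(congr1 val); rewrite valb => e0.
  apply/ffunP => i; apply/eqP; rewrite -subr_eq0; apply/eqP.
  pose m j := if insub j is Some i then k i - l i else 0.
  have := indep m _ i (ltn_ord i); rewrite /m valK; apply.
  by rewrite -[RHS]e0; apply: eq_bigr => j _; rewrite valK.
have [k ek] := (gB c).1 cB; exists [ffun i : 'I_(size g) => k i].
apply: val_inj; rewrite valb /= ek.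
by apply: eq_bigr => i _; rewrite ffunE.
Qed.

Lemma presented_hccat K : presented (full_sub C) K ->
  (hccat_complex R C <= (K%:R)%:E)%E.
Proof.
move=> [B [g [_ acy bas [N gN] siz]]].
apply: le_trans (_ : rank_complex R (complex_of_sub B) <= _)%E.
  apply: ereal_inf_lbound; exists B => //; split; last exact: rel_acyclic_quasi_iso.
  exists N => p c Np /(bas p).1[k ->]; rewrite big1 // => i _.
  by case: i => i /=; rewrite gN.
apply: lime_le; first by apply: is_cvg_nneseries => *; exact: rank_ge0.
apply: nearW => m; apply: le_trans (_ : (\sum_(0 <= p < m) ((size (g p))%:R)%:E <= _)%E).
  by apply: lee_sum => p _; apply: rank_sub_free.
by rewrite sumEFin lee_fin -natr_sum ler_nat big_mkord.
Qed.

Definition nonbounding p (c : C p) := bdp c = 0 /\ forall e, bd C p e <> c.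

(** A quasi-isomorphic subcomplex contains a chain homologous to the nonbounding cycle [c]. That
    chain is nonzero, so its chain group has rank at least 1, and distinct degrees add up. *)
Lemma hccat_ge (s : seq nat) : uniq s ->
  (forall p, p \in s -> exists c : C p, nonbounding c) ->
  (((size s)%:R)%:E <= hccat_complex R C)%E.
Proof.
move=> us hs; apply: le_ereal_inf_tmp => _ [B [_ qi] <-].
have [m sm] : exists m, forall p, p \in s -> (p < m)%N.
  exists (\max_(p <- s) p).+1 => p ps; rewrite ltnS.
  exact: (@leq_bigmax_seq _ s xpredT id).
apply: le_trans (nneseries_lim_ge m _); last by move=> *; exact: rank_ge0.
apply: le_trans (_ : (\sum_(0 <= p < m) ((p \in s)%:R)%:E <= _)%E).
  rewrite sumEFin lee_fin -natr_sum ler_nat.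
  have -> : (\sum_(0 <= p < m) (p \in s))%N = size [seq p <- index_iota 0 m | p \in s].
    by rewrite size_filter -sum1_count [RHS]big_mkcond; apply: eq_bigr => p; case: in_mem.
  by apply: uniq_leq_size => // p ps; rewrite mem_filter ps mem_index_iota sm.
apply: lee_sum => p _; case: (boolP (p \in s)) => [ps|_]; last exact: rank_ge0.
have [c [c0 nc]] := hs p ps; have [e ceB] := quasi_iso_cycle qi c0.
suff : (1 <= rank R (complex_of_sub B p))%E by [].
pose b : complex_of_sub B p := exist _ (c - bd C p e) ceB.
apply: (@rank_ge1 R (complex_of_sub B p) b).
apply/eqP => /(congr1 val) /= ce0; apply: (nc e).
by apply/esym/eqP; rewrite -subr_eq0 ce0.
Qed.

End HcCat.

(** * Affine singular simplices *)

Lemma continuous_sumr (K : numFieldType) (T : topologicalType) (I : Type)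
    (r : seq I) (f : I -> T -> K) :
  (forall j, continuous (f j)) -> continuous (fun t => \sum_(j <- r) f j t).
Proof.
move=> cf; elim: r => [|j r IH].
  rewrite (_ : (fun _ => _) = fun=> 0); first by move=> t; exact: cvg_cst.
  by apply/funext => t; rewrite big_nil.
rewrite (_ : (fun _ => _) = fun t => f j t + \sum_(j <- r) f j t).
  by move=> t; apply: cvgD; [exact: cf | exact: IH].
by apply/funext => t; rewrite big_cons.
Qed.

Section Simplex.
Variable R : realType.
Local Notation Delta n := (@std_simplex R n).

Definition coord n (t : Delta n) (i : 'I_n.+1) : R := val t ord0 i.

Lemma coord_ge0 n (t : Delta n) i : 0 <= coord t i.
Proof. by have [h _] := set_mem (valP t); exact: h. Qed.

Lemma coord_sum n (t : Delta n) : \sum_i coord t i = 1.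
Proof. by have [_ h] := set_mem (valP t); exact: h. Qed.

Lemma coord_inj n (t u : Delta n) : coord t =1 coord u -> t = u.
Proof. by move=> tu; apply: val_inj; apply/rowP => i; exact: tu. Qed.

Definition mk_simplex n (f : 'I_n.+1 -> R) (f0 : forall i, 0 <= f i)
    (f1 : \sum_i f i = 1) : Delta n.
Proof.
exists (\row_i f i); apply/mem_set; split=> [i|]; first by rewrite mxE.
by rewrite -f1; apply: eq_bigr => i _; rewrite mxE.
Defined.

Lemma coord_mk n (f : 'I_n.+1 -> R) f0 f1 i : coord (@mk_simplex n f f0 f1) i = f i.
Proof. by rewrite /coord mxE. Qed.

Lemma coord_le1 n (t : Delta n) i : coord t i <= 1.
Proof.
rewrite -(coord_sum t) (bigD1 i) //= lerDl sumr_ge0 // => j _.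
exact: coord_ge0.
Qed.

Lemma coord_continuous_simplex n i : continuous (fun t : Delta n => coord t i).
Proof.
move=> t; apply: (@continuous_comp _ _ _ (val : Delta n -> 'rV[R]_n.+1)
  (fun M : 'rV[R]_n.+1 => M ord0 i)); last exact: coord_continuous.
exact: initial_continuous.
Qed.

Lemma simplex_continuous (T : topologicalType) n (f : T -> Delta n) x :
  (forall i, {for x, continuous (fun y => coord (f y) i)}) -> {for x, continuous f}.
Proof.
move=> cf U [_ [[W oW <-] Wx sWU]] /=.
suff : nbhs x (f @^-1` (val @^-1` W))%classic by apply: filterS => y /sWU.
have : nbhs (val (f x)) W by exact: open_nbhs_nbhs.
case=> P nP PW.
suff : \forall y \near x, forall i, P ord0 i (coord (f y) i).
  by apply: filterS => y Py; apply: PW => i j; rewrite (ord1 i); exact: Py.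
apply: filter_forall => i.
exact: (cf i) (nP ord0 i).
Qed.

Definition vertex n (j : 'I_n.+1) : Delta n.
Proof.
apply: (@mk_simplex n (fun i => (i == j)%:R)) => [i|]; first by rewrite ler0n.
by rewrite (bigD1 j) //= eqxx big1 ?addr0 // => i /negPf ->.
Defined.

Lemma coord_vertex n (j i : 'I_n.+1) : coord (vertex j) i = (i == j)%:R.
Proof. exact: coord_mk. Qed.

Section Affine.
Variables (m n : nat) (v : 'I_m.+1 -> Delta n).

Definition aff_fun (t : Delta m) : Delta n.
Proof.
apply: (@mk_simplex n (fun i => \sum_j coord t j * coord (v j) i)) => [i|].
  by apply: sumr_ge0 => j _; rewrite mulr_ge0 ?coord_ge0.
rewrite exchange_big /= -(coord_sum t); apply: eq_bigr => j _.
by rewrite -mulr_sumr coord_sum mulr1.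
Defined.

Lemma coord_aff_fun t i : coord (aff_fun t) i = \sum_j coord t j * coord (v j) i.
Proof. exact: coord_mk. Qed.

Lemma aff_continuous : continuous aff_fun.
Proof.
move=> t; apply: simplex_continuous => i; move: t.
rewrite (_ : (fun y => _) = fun t => \sum_j coord t j * coord (v j) i).
  apply: continuous_sumr => j t; apply: continuousM; last exact: cst_continuous.
  exact: coord_continuous_simplex.
by apply/funext => t; exact: coord_aff_fun.
Qed.

Definition aff : continuousType (Delta m) (Delta n) := mkcts aff_continuous.

Lemma coord_aff t i : coord (aff t) i = \sum_j coord t j * coord (v j) i.
Proof. exact: coord_aff_fun. Qed.

End Affine.

Lemma aff_vertex m n (v : 'I_m.+1 -> Delta n) j : aff v (vertex j) = v j.
Proof.
apply: coord_inj => i; rewrite coord_aff (bigD1 j) //= coord_vertex eqxx mul1r.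
by rewrite big1 ?addr0 // => k /negPf kj; rewrite coord_vertex kj mul0r.
Qed.

Lemma aff_id n : aff (@vertex n) = idfun :> continuousType (Delta n) (Delta n).
Proof.
apply/continuousEP => t; apply: coord_inj => i; rewrite coord_aff (bigD1 i) //=.
rewrite coord_vertex eqxx mulr1 big1 ?addr0 // => k ki.
by rewrite coord_vertex eq_sym (negPf ki) mulr0.
Qed.

Lemma aff_comp l m n (w : 'I_m.+1 -> Delta n) (v : 'I_l.+1 -> Delta m) t :
  aff w (aff v t) = aff (fun j => aff w (v j)) t.
Proof.
apply: coord_inj => i; rewrite !coord_aff.
under eq_bigr do rewrite coord_aff mulr_suml.
rewrite exchange_big /=; apply: eq_bigr => j _.
by rewrite coord_aff mulr_sumr; apply: eq_bigr => k _; rewrite mulrA.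
Qed.

Lemma face_aff n (i : 'I_n.+2) (t : Delta n) :
  face i t = aff (fun j => vertex (lift i j)) t.
Proof.
apply: coord_inj => k; rewrite coord_aff /coord /= mxE.
case: unliftP => [j|] -> /=.
  rewrite (bigD1 j) //= [X in _ * X]coord_vertex eqxx mulr1 big1 ?addr0 // => l lj.
  by rewrite [X in _ * X]coord_vertex (inj_eq lift_inj) eq_sym (negPf lj) mulr0.
by rewrite big1 // => j _; rewrite [X in _ * X]coord_vertex (negPf (neq_lift _ _)) mulr0.
Qed.

Definition barycenter n : Delta n.
Proof.
apply: (@mk_simplex n (fun=> n.+1%:R^-1)) => [i|]; first by rewrite invr_ge0.
by rewrite sumr_const card_ord -[LHS]mulr_natr mulVf.
Defined.

Lemma coord_barycenter n i : coord (barycenter n) i = n.+1%:R^-1.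
Proof. exact: coord_mk. Qed.

(* Doeblin's condition: the weight put on a common coordinate makes averaging by v
   contract oscillations by the factor [1 - 1/(n+1)], which replaces the estimate of
   the diameters of the simplices of the barycentric subdivision. *)
Definition doeblin n m (v : 'I_m.+1 -> Delta n) :=
  exists l, forall j, n.+1%:R^-1 <= coord (v j) l.

Definition oscillation_le m n (v : 'I_m.+1 -> Delta n) (e : R) :=
  forall i j l, coord (v i) l - coord (v j) l <= e.

(** The weight [c] that both convex combinations put on [l] cancels in the difference. The remaining
    weights are nonnegative of total [1 - c], so each remaining sum lies between [1 - c] times the
    minimum and [1 - c] times the maximum of [W]. *)
Lemma doeblin_oscillation n m (w : 'I_n.+1 -> Delta m) (v : 'I_n.+1 -> Delta n) e :
  doeblin v -> oscillation_le w e ->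
  oscillation_le (fun j => aff w (v j)) ((1 - n.+1%:R^-1) * e).
Proof.
move=> [l vl] we i j k; rewrite !coord_aff.
set c := n.+1%:R^-1 in vl *; pose W a := coord (w a) k.
have c1 : 0 <= 1 - c.
  by rewrite subr_ge0 invf_le1 ?ltr0n // ler1n.
pose p i' a := coord (v i') a - c * (a == l)%:R.
have pE i' : \sum_a coord (v i') a * W a = c * W l + \sum_a p i' a * W a.
  under [X in _ = _ + X]eq_bigr do rewrite mulrBl.
  rewrite sumrB addrCA [X in _ = _ + (_ - X)](bigD1 l) //= eqxx mulr1.
  rewrite [X in _ - (_ + X)]big1 ?addr0 ?subrr ?addr0 // => a /negPf ->.
  by rewrite mulr0 mul0r.
have p0 i' a : 0 <= p i' a.
  rewrite /p; have [->|al] := eqVneq a l; first by rewrite mulr1 subr_ge0.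
  by rewrite mulr0 subr0 coord_ge0.
have p1 i' : \sum_a p i' a = 1 - c.
  rewrite sumrB coord_sum (bigD1 l) //= eqxx mulr1 big1 ?addr0 // => a /negPf ->.
  by rewrite mulr0.
have [M hM] : exists M, forall a, W a <= W M.
  by case: (@Order.TotalTheory.arg_maxP _ _ _ ord0 xpredT W isT) => M _ h; exists M => a; exact: h.
have [b hb] : exists b, forall a, W b <= W a.
  by case: (@Order.TotalTheory.arg_minP _ _ _ ord0 xpredT W isT) => b _ h; exists b => a; exact: h.
rewrite !pE opprD addrACA subrr add0r.
apply: (@le_trans _ _ ((1 - c) * W M - (1 - c) * W b)).
  apply: lerB.
    by rewrite -(p1 i) mulr_suml; apply: ler_sum => a _; rewrite ler_wpM2l.
  by rewrite -(p1 j) mulr_suml; apply: ler_sum => a _; rewrite ler_wpM2l.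
by rewrite -mulrBr ler_wpM2l // we.
Qed.

Lemma aff_oscillation n m (v : 'I_m.+1 -> Delta n) e t i l :
  oscillation_le v e -> `|coord (aff v t) l - coord (v i) l| <= e.
Proof.
move=> ve; rewrite coord_aff -[X in _ - X]mul1r -(coord_sum t) mulr_suml -sumrB.
apply: le_trans (ler_norm_sum _ _ _) _.
rewrite -[leRHS]mul1r -(coord_sum t) mulr_suml; apply: ler_sum => j _.
rewrite -mulrBr normrM ger0_norm ?coord_ge0 // ler_wpM2l ?coord_ge0 //.
by rewrite ler_norml ve andbT lerNl opprB ve.
Qed.

End Simplex.

Section Lebesgue.
Variable R : realType.
Local Notation Delta n := (@std_simplex R n).

Lemma simplex_compact n : compact (@std_simplex R n).
Proof.
apply: bounded_closed_compact.
  exists 1; split; first exact: num_real.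
  move=> M M1 t tS /=; rewrite /Num.norm /= mx_normrE.
  apply: bigmax_le => [|[i j] _ /=]; first by rewrite ltW // (lt_trans ltr01).
  rewrite (ord1 i); have := coord_le1 (exist _ t (mem_set tS)) j.
  have := coord_ge0 (exist _ t (mem_set tS)) j; rewrite /coord /= => t0 t1.
  by rewrite ger0_norm // (le_trans t1) // ltW.
rewrite (_ : @std_simplex R n = (\bigcap_i [set t : 'rV[R]_n.+1 | 0 <= t ord0 i]) `&`
    [set t : 'rV[R]_n.+1 | \sum_i t ord0 i = 1])%classic.
  apply: closedI.
    apply: closed_bigI => i _.
    apply: (closed_comp (f := fun t : 'rV[R]_n.+1 => t ord0 i) (D := [set x | 0 <= x]%classic)).
      by move=> t _; exact: coord_continuous.
    exact: closed_ge.
  apply: (closed_comp (f := fun t : 'rV[R]_n.+1 => \sum_i t ord0 i) (D := [set 1]%classic)).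
    move=> t _; apply: continuous_sumr => j; exact: coord_continuous.
  exact: closed_eq.
apply/seteqP; split=> t /=.
  by move=> [t0 t1]; split=> // i _ /=.
by move=> [t0 t1]; split=> // i; exact: t0.
Qed.

(** The radius has the form [q ^+ k] because this is the oscillation left after [k] subdivisions.
    Compactness extracts a uniform [k] from the local statement [loc], in which point and exponent
    vary together. *)
Lemma lebesgue_number (Y : topologicalType) n (s : continuousType (Delta n) Y)
    (A U : set Y) (q : R) :
  open A -> open U -> (forall t, A (s t) \/ U (s t)) -> 0 <= q < 1 ->
  exists k, forall x : Delta n,
    (forall y : Delta n, (forall l, `|coord y l - coord x l| <= q ^+ k) -> A (s y)) \/
    (forall y : Delta n, (forall l, `|coord y l - coord x l| <= q ^+ k) -> U (s y)).
Proof.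
move=> oA oU cov /andP[q0 q1].
have q_small (e : R) : 0 < e -> \forall k \near \oo%classic, q ^+ k < e.
  move=> e0; have /cvgrPdist_lt/(_ e e0) : (q ^+ k @[k --> \oo] --> 0)%classic.
    by apply: cvg_expr; rewrite ger0_norm.
  by apply: filterS => k; rewrite sub0r normrN ger0_norm // exprn_ge0.
pose P k (x : 'rV[R]_n.+1) :=
  (forall y : Delta n, (forall l, `|coord y l - x ord0 l| <= q ^+ k) -> A (s y)) \/
  (forall y : Delta n, (forall l, `|coord y l - x ord0 l| <= q ^+ k) -> U (s y)).
have loc (B : set Y) (t : Delta n) : open B -> B (s t) ->
    (\forall x \near (val t : 'rV[R]_n.+1) & k \near \oo%classic,
      forall y : Delta n, (forall l, `|coord y l - (x : 'rV[R]_n.+1) ord0 l| <= q ^+ k) -> B (s y)).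
  move=> oB Bt.
  have : nbhs t (s @^-1` B)%classic.
    by apply: (@cts_fun _ _ s t); exact: open_nbhs_nbhs.
  move=> [_ [[W oW <-] Wt WB]].
  have /nbhs_ballP[e /= e0 eW] : nbhs (val t) W by exact: open_nbhs_nbhs.
  (* One half of the radius is spent between [t] and [x], the other between [x] and [y]. *)
  have e20 : 0 < e / 2 by rewrite divr_gt0.
  exists (ball (val t) (e / 2), [set k | q ^+ k < e / 2]%classic).
    by split; [exact: nbhsx_ballx | exact: q_small].
  move=> [x k] /= [[_ tx] qk] y yx; apply: WB; apply: eW; split=> // i j.
  rewrite (ord1 i) [e]splitr; apply: ball_triangle (tx ord0 j) _.
  by rewrite /ball /= distrC (le_lt_trans (yx j)).
have : compact (@std_simplex R n) by exact: simplex_compact.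
move=> /compact_near_coveringP/(_ nat \oo%classic P _)[].
  move=> x xS; pose t : Delta n := exist _ x (mem_set xS).
  case: (cov t) => h.
    by have := loc A t oA h; apply: filterS => -[x' k] /= h'; left.
  by have := loc U t oU h; apply: filterS => -[x' k] /= h'; right.
move=> N _ hN; exists N => x.
exact: (hN N (leqnn N) (val x) (set_mem (valP x))).
Qed.

End Lebesgue.

(** * Free abelian groups and singular chains *)

Section FreeGroup.
Implicit Types K L : choiceType.

HB.instance Definition _ K (M : lmodType int) (f : K -> M) :=
  GRing.isZmodMorphism.Build {freeg K / int} M (fglift f) (lift_is_additive f).

Lemma fgliftU K (M : lmodType int) (f : K -> M) x : fglift f << x >> = f x.
Proof. by rewrite liftU scale1r. Qed.

Definition fsupp K (P : K -> Prop) (c : {freeg K / int}) :=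
  forall s, s \in dom c -> P s.

Lemma fsupp0 K (P : K -> Prop) : fsupp P 0.
Proof. by move=> s; rewrite dom0. Qed.

Lemma fsuppB K (P : K -> Prop) c c' : fsupp P c -> fsupp P c' -> fsupp P (c - c').
Proof. by move=> Pc Pc' s /domB; rewrite mem_cat => /orP[/Pc|/Pc']. Qed.

Lemma fsuppN K (P : K -> Prop) c : fsupp P c -> fsupp P (- c).
Proof. by move=> Pc s; rewrite domN; exact: Pc. Qed.

Lemma fsuppD K (P : K -> Prop) c c' : fsupp P c -> fsupp P c' -> fsupp P (c + c').
Proof. by move=> Pc Pc'; rewrite -[c']opprK; apply: fsuppB => //; exact: fsuppN. Qed.

Lemma fsuppZ K (P : K -> Prop) (k : int) c : fsupp P c -> fsupp P (k *: c).
Proof. by move=> Pc s /domZ_subset; exact: Pc. Qed.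

Lemma fsupp_sum K (P : K -> Prop) (I : Type) (r : seq I) (Q : pred I)
    (F : I -> {freeg K / int}) :
  (forall i, Q i -> fsupp P (F i)) -> fsupp P (\sum_(i <- r | Q i) F i).
Proof.
by move=> PF; apply: (big_ind (fsupp P)) => //; [exact: fsupp0 | exact: fsuppD].
Qed.

Lemma fsuppU K (P : K -> Prop) x : fsupp P << x >> <-> P x.
Proof.
by split=> [|Px y]; [apply; rewrite domU1 inE | rewrite domU1 inE => /eqP->].
Qed.

Lemma fsupp_sub K (P Q : K -> Prop) c : (forall s, P s -> Q s) -> fsupp P c -> fsupp Q c.
Proof. by move=> PQ Pc s /Pc /PQ. Qed.

Lemma fsuppT K (P : K -> Prop) c : (forall s, P s) -> fsupp P c.
Proof. by move=> Ps s _. Qed.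

(** Closure under differences already gives all integer combinations, and it is the form that
    additive maps verify directly. *)
Lemma fsupp_ind K (P : K -> Prop) (Q : {freeg K / int} -> Prop) :
  Q 0 -> (forall c c', Q c -> Q c' -> Q (c - c')) -> (forall s, P s -> Q << s >>) ->
  forall c, fsupp P c -> Q c.
Proof.
move=> Q0 QB QU c Pc.
have QD a b : Q a -> Q b -> Q (a + b).
  by move=> Qa Qb; rewrite -[b]opprK -[- b]add0r; do 2?apply: (QB _) => //.
rewrite -[c]freeg_sumE big_seq; apply: (big_ind Q) => // s /Pc Ps.
rewrite -[coeff s c]intz -freegU_mulz.
case: (coeff s c) => n; rewrite ?NegzE ?mulrNz -pmulrn -?mulNrn.
  elim: n => [|n IH]; rewrite ?mulr0n // mulrS.
  by apply: QD => //; exact: QU.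
elim: n.+1 => [|m IH]; rewrite ?mulr0n // mulrS addrC.
by apply: QB => //; exact: QU.
Qed.

Lemma fglift_ext K (M : zmodType) (F G : {freeg K / int} -> M) (P : K -> Prop) c :
  zmod_morphism F -> zmod_morphism G ->
  (forall s, P s -> F << s >> = G << s >>) -> fsupp P c -> F c = G c.
Proof.
move=> FB GB FG; move: c; apply: fsupp_ind => //; last first.
  by move=> c c' Fc Fc'; rewrite FB GB Fc Fc'.
by rewrite -(subrr 0) FB GB !subrr.
Qed.

Lemma fsupp_lift K L (P : K -> Prop) (Q : L -> Prop) (f : K -> {freeg L / int}) c :
  (forall s, P s -> fsupp Q (f s)) -> fsupp P c -> fsupp Q (fglift f c).
Proof.
move=> PQ; move: c; apply: fsupp_ind => [|c c' Fc Fc'|s /PQ]; rewrite ?fgliftU //.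
  by rewrite raddf0; exact: fsupp0.
by rewrite raddfB; exact: fsuppB.
Qed.

Lemma fsupp_or K (P Q : K -> Prop) c : fsupp (fun s => P s \/ Q s) c ->
  exists a, exists2 b, fsupp P a /\ fsupp Q b & c = a + b.
Proof.
move: c; apply: fsupp_ind => [|c c'|s].
- by exists 0, 0; [split; exact: fsupp0 | rewrite addr0].
- move=> [a [b [Pa Qb] ->]] [a' [b' [Pa' Qb'] ->]].
  exists (a - a'), (b - b'); first by split; exact: fsuppB.
  by rewrite opprD addrACA.
- move=> [Ps|Qs]; [exists << s >>, 0 | exists 0, << s >>];
    rewrite ?addr0 ?add0r //; split; by [exact/fsuppU|exact: fsupp0].
Qed.

End FreeGroup.

Section Push.
Variable R : realType.
Local Notation S Y n := (sing_chain R Y n).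
Implicit Types X Y Z W : topologicalType.

Definition ccomp X Y Z (g : continuousType Y Z) (f : continuousType X Y) :
  continuousType X Z := g \o f.

Lemma ccompA X Y Z W (h : continuousType Z W) (g : continuousType Y Z)
  (f : continuousType X Y) : ccomp h (ccomp g f) = ccomp (ccomp h g) f.
Proof. exact/continuousEP. Qed.

Lemma ccompid X Y (f : continuousType X Y) : ccomp f (idfun : continuousType X X) = f.
Proof. exact/continuousEP. Qed.

Definition push Y Z (g : continuousType Y Z) n : S Y n -> S Z n :=
  fglift (fun s => << ccomp g s >>).

HB.instance Definition _ Y Z (g : continuousType Y Z) n :=
  GRing.isZmodMorphism.Build (S Y n) (S Z n) (@push Y Z g n) (lift_is_additive _).

Lemma pushU Y Z (g : continuousType Y Z) n (s : sing R Y n) :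
  push g << s >> = << ccomp g s >>.
Proof. exact: fgliftU. Qed.

Lemma push_supp Y Z (g : continuousType Y Z) n (P : sing R Y n -> Prop)
    (Q : sing R Z n -> Prop) c :
  (forall s, P s -> Q (ccomp g s)) -> fsupp P c -> fsupp Q (push g c).
Proof. by move=> PQ; apply: fsupp_lift => s /PQ; exact: (fsuppU Q _).2. Qed.

Lemma sing_ext Y (M : zmodType) n (F G : S Y n -> M) c :
  zmod_morphism F -> zmod_morphism G ->
  (forall s : sing R Y n, F << s >> = G << s >>) -> F c = G c.
Proof.
by move=> FB GB FG; apply: (@fglift_ext _ _ F G (fun=> True)) => // s _; exact: FG.
Qed.

Lemma push_comp X Y Z (h : continuousType Y Z) (g : continuousType X Y) n (c : S X n) :
  push h (push g c) = push (ccomp h g) c.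
Proof.
apply: (@sing_ext X (S Z n : zmodType) n (fun c => push h (push g c)) (@push _ _ (ccomp h g) n)) => [x y|x y|s].
- by rewrite !raddfB.
- by rewrite raddfB.
- by rewrite !pushU ccompA.
Qed.

Lemma pushZ Y Z (g : continuousType Y Z) n (k : int) (c : S Y n) :
  push g (k *: c) = k *: push g c.
Proof. by rewrite -[k]intz !scaler_int raddfMz. Qed.

Lemma push_bd Y Z (g : continuousType Y Z) n (c : S Y n.+1) :
  push g (sing_bd c) = sing_bd (push g c).
Proof.
apply: (@sing_ext Y (S Z n : zmodType) n.+1 (fun c => push g (sing_bd c)) (fun c => sing_bd (push g c)))
  => [x y|x y|s]; rewrite ?raddfB //.
rewrite pushU !sing_bdU raddf_sum /=; apply: eq_bigr => i _.
rewrite pushZ pushU; congr (_ *: << _ >>); exact/continuousEP.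
Qed.

End Push.

(** * Barycentric subdivision *)

Section Subdivision.
Variable R : realType.
Local Notation Delta n := (@std_simplex R n).
Local Notation S Y n := (sing_chain R Y n).

Lemma sing_face_aff m n (i : 'I_m.+2) (v : 'I_m.+2 -> Delta n) :
  sing_face i (aff v : sing R (Delta n) m.+1) = aff (fun j => v (lift i j)).
Proof.
apply/continuousEP => t; rewrite [LHS](_ : _ = aff v (face i t)) // face_aff aff_comp.
by congr (aff _ t); apply/funext => j; rewrite aff_vertex.
Qed.

Lemma face_vertex m (i : 'I_m.+2) j : face i (vertex R j) = vertex R (lift i j).
Proof. by rewrite face_aff aff_vertex. Qed.

Definition is_aff m n (s : sing R (Delta n) m) := s = aff (fun j => s (vertex R j)).

Lemma is_aff_aff m n (v : 'I_m.+1 -> Delta n) : is_aff (aff v).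
Proof. by rewrite /is_aff; congr aff; apply/funext => j; rewrite aff_vertex. Qed.

Lemma comp_aff l m n (w : 'I_m.+1 -> Delta n) (v : 'I_l.+1 -> Delta m) :
  ccomp (aff w) (aff v) = aff (fun j => aff w (v j)).
Proof. by apply/continuousEP => t; rewrite -aff_comp. Qed.

(** Only the vertices of [s] enter, with the apex [b] numbered 0; the face opposite to the apex is
    [s] itself when [s] is affine. *)
Definition cone_aff m n (b : Delta n) (s : sing R (Delta n) m) : sing R (Delta n) m.+1 :=
  aff (fun j => oapp (fun k => s (vertex R k)) b (unlift ord0 j)).

Lemma cone_aff_face0 m n (b : Delta n) (s : sing R (Delta n) m) :
  is_aff s -> sing_face ord0 (cone_aff b s) = s.
Proof.
move=> saff; rewrite /cone_aff sing_face_aff [RHS]saff; congr aff.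
by apply/funext => j; rewrite liftK.
Qed.

Lemma cone_aff_faceS m n (b : Delta n) (s : sing R (Delta n) m.+1) i :
  sing_face (lift ord0 i) (cone_aff b s) = cone_aff b (sing_face i s).
Proof.
rewrite /cone_aff sing_face_aff; congr aff; apply/funext => j.
case: (unliftP ord0 j) => [k|] -> /=.
  have -> : lift (lift ord0 i) (lift ord0 k) = lift ord0 (lift i k) :> 'I_m.+3.
    by apply: val_inj; rewrite /= /bump /=; lia.
  by rewrite liftK /= -face_vertex.
have -> : lift (lift ord0 i) ord0 = ord0 :> 'I_m.+3 by apply: val_inj.
by rewrite unlift_none.
Qed.

Definition cone_chain m n (b : Delta n) : S (Delta n) m -> S (Delta n) m.+1 :=
  fglift (fun s => << cone_aff b s >>).

HB.instance Definition _ m n (b : Delta n) :=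
  GRing.isZmodMorphism.Build (S (Delta n) m) (S (Delta n) m.+1) (@cone_chain m n b)
    (lift_is_additive _).

Lemma cone_chainU m n (b : Delta n) (s : sing R (Delta n) m) :
  cone_chain b << s >> = << cone_aff b s >>.
Proof. exact: fgliftU. Qed.

Lemma cone_chain_bd m n (b : Delta n) (c : S (Delta n) m.+1) :
  fsupp (@is_aff m.+1 n) c ->
  sing_bd (cone_chain b c) = c - cone_chain b (sing_bd c).
Proof.
apply: (@fglift_ext _ (S (Delta n) m.+1 : zmodType) (fun c => sing_bd (cone_chain b c))
  (fun c => c - cone_chain b (sing_bd c))) => [x y|x y|s saff].
- by rewrite !raddfB.
- by rewrite !raddfB /= addrACA.
rewrite cone_chainU !sing_bdU big_ord_recl expr0 scale1r cone_aff_face0 //.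
rewrite raddf_sum -sumrN; congr (_ + _); apply: eq_bigr => i _ /=.
rewrite cone_aff_faceS exprS mulN1r scaleNr; congr (- _).
by rewrite -[(-1) ^+ i]intz !scaler_int raddfMz /= cone_chainU.
Qed.

Definition sing_id n : sing R (Delta n) n := idfun.

(* The value on the identity simplex of a natural chain homotopy from the
   identity to the barycentric subdivision. *)
Fixpoint homotopy n : S (Delta n) n.+1 :=
  match n with
  | 0 => 0
  | m.+1 => cone_chain (barycenter R m.+1)
      (<< sing_id _ >> - fglift (fun s => push s (homotopy m)) (sing_bd << sing_id _ >>))
  end.

Definition sd_htpy (Y : topologicalType) n : S Y n -> S Y n.+1 :=
  fglift (fun s => push s (homotopy n)).

HB.instance Definition _ (Y : topologicalType) n :=
  GRing.isZmodMorphism.Build (S Y n) (S Y n.+1) (@sd_htpy Y n) (lift_is_additive _).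

Lemma sd_htpyU (Y : topologicalType) n (s : sing R Y n) :
  sd_htpy << s >> = push s (homotopy n).
Proof. exact: fgliftU. Qed.

Lemma sd_htpy_push (Y Z : topologicalType) (g : continuousType Y Z) n (c : S Y n) :
  sd_htpy (push g c) = push g (sd_htpy c).
Proof.
apply: (@sing_ext _ _ (S Z n.+1 : zmodType) n (fun c => sd_htpy (push g c))
  (fun c => push g (sd_htpy c))) => [x y|x y|s]; rewrite ?raddfB //.
by rewrite pushU !sd_htpyU push_comp.
Qed.

Lemma sd_htpy_supp (Y : topologicalType) n (P : sing R Y n -> Prop)
    (Q : sing R Y n.+1 -> Prop) c :
  (forall s v, P s -> Q (ccomp s v)) -> fsupp P c -> fsupp Q (sd_htpy c).
Proof.
move=> PQ; apply: fsupp_lift => s Ps; apply: (@push_supp _ _ _ _ _ (fun=> True)).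
  by move=> v _; exact: PQ.
exact: fsuppT.
Qed.

Lemma sing_bd_supp (Y : topologicalType) n (P : sing R Y n.+1 -> Prop)
    (Q : sing R Y n -> Prop) c :
  (forall s v, P s -> Q (ccomp s v)) -> fsupp P c -> fsupp Q (sing_bd c).
Proof.
move=> PQ; apply: fsupp_lift => s Ps; apply: fsupp_sum => i _.
by apply: fsuppZ; apply/fsuppU; exact: PQ.
Qed.

Lemma homotopy_aff n : fsupp (@is_aff n.+1 n) (homotopy n).
Proof.
case: n => [|n] /=; first exact: fsupp0.
apply: (@fsupp_lift _ _ (fun=> True)); last exact: fsuppT.
by move=> s _; apply/fsuppU; exact: is_aff_aff.
Qed.

(** Subdivision is defined from the homotopy, as the identity minus the homotopy terms. Being
    homotopic to the identity and commuting with the differential are then formal, and only the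
    shape of its simplices remains to be proved. *)
Definition sd (Y : topologicalType) n : S Y n -> S Y n :=
  match n return S Y n -> S Y n with
  | 0 => fun c => c - sing_bd (sd_htpy c)
  | m.+1 => fun c => c - (sing_bd (sd_htpy c) + sd_htpy (sing_bd c))
  end.

Lemma sd_additive (Y : topologicalType) n : zmod_morphism (@sd Y n).
Proof.
case: n => [|n] x y /=; first by rewrite !raddfB /= addrACA.
rewrite !raddfB /= [X in _ - X]addrACA -(opprD (sing_bd (sd_htpy y))).
by rewrite raddfB addrACA.
Qed.

HB.instance Definition _ (Y : topologicalType) n :=
  GRing.isZmodMorphism.Build (S Y n) (S Y n) (@sd Y n) (@sd_additive Y n).

Lemma sd_push (Y Z : topologicalType) (g : continuousType Y Z) n (c : S Y n) :
  sd (push g c) = push g (sd c).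
Proof.
case: n c => [|n] c /=; rewrite [RHS]raddfB /= ?raddfD /= push_bd -!sd_htpy_push //.
by rewrite push_bd.
Qed.

Lemma sd_bd (Y : topologicalType) n (c : S Y n.+1) : sd (sing_bd c) = sing_bd (sd c).
Proof.
have -> : sing_bd (sd c) = sing_bd c - sing_bd (sd_htpy (sing_bd c)).
  by rewrite raddfB /= raddfD /= sing_bdK add0r.
by case: n c => [|n] c //=; rewrite sing_bdK raddf0 addr0.
Qed.

Definition doeblin_aff n (s : sing R (Delta n) n) :=
  exists2 v, s = aff v & doeblin v.

(** The vertices of a simplex of the subdivision are barycenters of a flag of faces. All these faces
    contain the vertex [l] at the bottom of the flag, and a barycenter gives each vertex of its face
    weight at least [1/(n+1)]. *)
Lemma sd_id_doeblin n : fsupp (@doeblin_aff n) (sd << sing_id _ >>).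
Proof.
elim: n => [|n IH].
  rewrite /= sd_htpyU raddf0 raddf0 subr0; apply/fsuppU.
  exists (@vertex R 0); first by rewrite -[sing_id 0]aff_id.
  by exists ord0 => j; rewrite coord_vertex (ord1 j) eqxx invr1.
pose i : S (Delta n.+1) n.+1 := << sing_id n.+1 >>.
have htE : sd_htpy i = cone_chain (barycenter R n.+1) (i - sd_htpy (sing_bd i)).
  rewrite /i sd_htpyU; apply: (@sing_ext _ _ (S (Delta n.+1) n.+2 : zmodType) _
    (@push _ _ _ (sing_id n.+1) n.+2) id) => [x y|//|s]; first by rewrite raddfB.
  by rewrite pushU; congr << _ >>; exact/continuousEP.
have affE : fsupp (@is_aff n.+1 n.+1) (i - sd_htpy (sing_bd i)).
  apply: fsuppB.
    by apply/fsuppU; rewrite /sing_id -aff_id; exact: is_aff_aff.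
  rewrite /i sing_bdU raddf_sum; apply: fsupp_sum => j _ /=.
  rewrite -[(-1) ^+ j]intz scaler_int raddfMz /= -scaler_int; apply: fsuppZ.
  rewrite sd_htpyU; apply: push_supp (@homotopy_aff n) => s ->.
  have -> : sing_face j (sing_id n.+1) = aff (fun k => vertex R (lift j k)).
    by rewrite -[sing_id n.+1]aff_id sing_face_aff.
  by rewrite comp_aff; exact: is_aff_aff.
(* This recovers the usual recursion. With [c0 = i - sd_htpy (sing_bd i)], the cone formula leaves
   the cone over the boundary of [c0], and that boundary is [sd (sing_bd i)]. *)
have sdE : sd i = cone_chain (barycenter R n.+1) (sd (sing_bd i)).
  rewrite [LHS]/= htE cone_chain_bd //; set c0 := i - sd_htpy _; set K := cone_chain _ (sing_bd c0).
  have -> : cone_chain (barycenter R n.+1) (sd (sing_bd i)) = K.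
    congr cone_chain; rewrite raddfB /=.
    by case: (n) i c0 K {htE affE} => [|m] i c0 K //=; rewrite sing_bdK raddf0 addr0.
  by apply/eqP; rewrite subr_eq addrA (addrC K) subrK subrK.
rewrite -/i sdE /i sing_bdU !raddf_sum; apply: fsupp_sum => j _ /=.
rewrite -[(-1) ^+ j]intz scaler_int 2!raddfMz /= -scaler_int; apply: fsuppZ.
have -> : << sing_face j (sing_id n.+1) >> =
    push (aff (fun k => vertex R (lift j k))) << sing_id n >>.
  rewrite pushU; congr << _ >>.
  by rewrite -[sing_id n.+1]aff_id sing_face_aff ccompid.
rewrite sd_push.
apply: (@fsupp_lift _ _ (fun s => exists2 v, s = aff v &
   exists l, forall k, n.+2%:R^-1 <= coord (v k) l)).
  move=> _ [v -> [l vl]]; apply/fsuppU.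
  exists (fun k => oapp v (barycenter R n.+1) (unlift ord0 k)).
    by rewrite /cone_aff; congr aff; apply/funext => k; case: unliftP => //= k' _;
       rewrite aff_vertex.
  exists l => k; case: unliftP => [k'|] _ /=; first exact: vl.
  by rewrite coord_barycenter.
apply: push_supp IH => _ [v -> [l vl]].
exists (fun k => aff (fun k => vertex R (lift j k)) (v k)); first exact: comp_aff.
(* The common coordinate [l] of the face becomes [lift j l]. Its weight is at least [1/(n+1)], hence
   at least the [1/(n+2)] that the barycenter puts on every coordinate. *)
exists (lift j l) => k; rewrite coord_aff (bigD1 l) //= coord_vertex eqxx mulr1.
rewrite ler_wpDr ?sumr_ge0 // => [k' _|].
  by rewrite mulr_ge0 ?coord_ge0.
by apply: le_trans (vl k); rewrite lef_pV2 ?posrE ?ltr0n // ler_nat.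
Qed.

End Subdivision.

(** * Small simplices *)

Section SmallSimplices.
Variables (R : realType) (Y : topologicalType).
Local Notation Delta n := (@std_simplex R n).
Local Notation S n := (sing_chain R Y n).
Local Notation C := (singular_complex R Y).
Implicit Types A B D E U : set Y.

Definition sing_in B n (s : sing R Y n) := forall t, B (s t).

Lemma sing_in_comp B m n (s : sing R Y n) (v : continuousType (Delta m) (Delta n)) :
  sing_in B s -> sing_in B (ccomp s v).
Proof. by move=> Bs t; exact: Bs. Qed.

Definition sing_sub_pred B n : {pred C n} := fun c => `[< fsupp (@sing_in B n) c >].

Lemma sing_sub_closed B n : zmod_closed (@sing_sub_pred B n).
Proof.
split=> [|x y]; rewrite !unfold_in; first by apply/asboolP; exact: fsupp0.
by move=> /asboolP Bx /asboolP By; apply/asboolP; exact: fsuppB.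
Qed.

Lemma sing_sub_bd B n (c : C n.+1) :
  c \in @sing_sub_pred B n.+1 -> bd C n c \in @sing_sub_pred B n.
Proof.
rewrite !unfold_in => /asboolP Bc; apply/asboolP.
by apply: sing_bd_supp Bc => s v; exact: sing_in_comp.
Qed.

Definition sing_sub B : subcomplex C :=
  Subcomplex (@sing_sub_closed B) (@sing_sub_bd B).

Lemma sing_subP B n (c : C n) : c \is_in sing_sub B <-> fsupp (@sing_in B n) c.
Proof. by rewrite /= unfold_in; split=> /asboolP. Qed.

Lemma sing_sub_le A B : (forall y, A y -> B y) ->
  forall n (c : C n), c \is_in sing_sub A -> c \is_in sing_sub B.
Proof.
move=> AB n c /sing_subP Ac; apply/sing_subP; apply: fsupp_sub Ac => s As t.
exact/AB/As.
Qed.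

Section Cover.
Variables A U E : set Y.
Hypotheses (oA : open A) (oU : open U) (AUE : forall y, E y <-> A y \/ U y).

Definition small n (s : sing R Y n) := sing_in A s \/ sing_in U s.

Lemma small_comp m n (s : sing R Y n) (v : continuousType (Delta m) (Delta n)) :
  small s -> small (ccomp s v).
Proof. by case=> h; [left|right]; exact: sing_in_comp. Qed.

Lemma sd_supp (P : forall n, sing R Y n -> Prop) :
  (forall m n (s : sing R Y n) (v : continuousType (Delta m) (Delta n)),
    P n s -> P m (ccomp s v)) ->
  forall n c, fsupp (P n) c -> fsupp (P n) (sd c).
Proof.
move=> Pc [|n] c Pn /=; apply: fsuppB => //.
  apply: (@sing_bd_supp _ _ _ (P 1%N)) => [s v|]; first exact: Pc.
  by apply: sd_htpy_supp Pn => s v; exact: Pc.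
apply: fsuppD.
  apply: (@sing_bd_supp _ _ _ (P n.+2)) => [s v|]; first exact: Pc.
  by apply: sd_htpy_supp Pn => s v; exact: Pc.
apply: (@sd_htpy_supp _ _ _ (P n)) => [s v|]; first exact: Pc.
by apply: sing_bd_supp Pn => s v; exact: Pc.
Qed.

(** By naturality, subdividing [ccomp s (aff v)] means pushing forward the subdivided identity
    simplex, each piece of which contracts the oscillation by the factor [1 - 1/(n+1)]. *)
Lemma iter_sd_supp n (s : sing R Y n) k :
  fsupp (fun s' => exists2 v, s' = ccomp s (aff v) &
    oscillation_le v ((1 - n.+1%:R^-1) ^+ k)) (iter k (@sd R Y n) << s >>).
Proof.
elim: k => [|k IH] /=.
  apply/fsuppU; exists (@vertex R n).
    by apply/continuousEP => t; rewrite aff_id.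
  move=> i j l; rewrite expr0; apply: le_trans (coord_le1 (vertex R i) l).
  by rewrite gerBl coord_ge0.
move: (iter _ _ _) IH; apply: fsupp_ind => [|c c' Hc Hc'|s' [v -> osc]].
- by rewrite raddf0; exact: fsupp0.
- by rewrite raddfB; exact: fsuppB.
have -> : << ccomp s (aff v) >> = push (ccomp s (aff v)) << sing_id R n >>.
  by rewrite pushU ccompid.
rewrite sd_push; apply: push_supp (@sd_id_doeblin R n) => _ [w -> dw].
exists (fun j => aff v (w j)); first by rewrite -ccompA comp_aff.
by rewrite exprS; exact: doeblin_oscillation.
Qed.

Lemma sing_eventually_small n (s : sing R Y n) : sing_in E s ->
  exists k, fsupp (@small n) (iter k (@sd R Y n) << s >>).
Proof.
move=> Es; have q01 : 0 <= (1 - n.+1%:R^-1 : R) < 1.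
  apply/andP; split; first by rewrite subr_ge0 invf_le1 ?ltr0n // ler1n.
  by rewrite ltrBlDr ltrDl invr_gt0 ltr0n.
have [k hk] := lebesgue_number oA oU (fun t => (AUE _).1 (Es t)) q01.
exists k; move: (@iter_sd_supp n s k); apply: fsupp_sub => _ [v -> osc].
case: (hk (v ord0)) => h; [left|right] => t; apply: h => l;
  exact: aff_oscillation.
Qed.

Lemma iter_sdB n k (c c' : S n) :
  iter k (@sd R Y n) (c - c') = iter k (@sd R Y n) c - iter k (@sd R Y n) c'.
Proof. by elim: k => //= k ->; rewrite raddfB. Qed.

(** Further subdivision preserves smallness, so the larger of two exponents serves both chains. *)
Lemma chain_eventually_small n (c : S n) : fsupp (@sing_in E n) c ->
  exists k, fsupp (@small n) (iter k (@sd R Y n) c).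
Proof.
move=> Ec.
have mono k k' (b : S n) : (k <= k')%N -> fsupp (@small n) (iter k (@sd R Y n) b) ->
    fsupp (@small n) (iter k' (@sd R Y n) b).
  move=> /subnK <- kb; rewrite iterD; elim: (k' - k)%N => //= m.
  by apply: sd_supp; exact: small_comp.
move: c Ec; apply: fsupp_ind => [|c c' [k kc] [k' kc']|s].
- by exists 0%N; exact: fsupp0.
- exists (maxn k k'); rewrite iter_sdB; apply: fsuppB.
    by apply: mono kc; rewrite leq_maxl.
  by apply: mono kc'; rewrite leq_maxr.
- exact: sing_eventually_small.
Qed.

(** The homotopy to the iterated subdivision has a term in [c], which gives [e], and a term in the
    boundary of [c], which is small because that boundary is. *)
Lemma sd_homotopic n k (c : C n) : fsupp (@sing_in E n) c ->
  fsupp (@small n.-1) (bdp c) ->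
  exists2 e : C n.+1, fsupp (@sing_in E n.+1) e &
    fsupp (@small n) (c - bd C n e - iter k (@sd R Y n) c).
Proof.
elim: k c => [|k IH] c Ec sc.
  by exists 0; [exact: fsupp0 | rewrite raddf0 subr0 subrr; exact: fsupp0].
have [|| e Ee he] := IH (sd c).
- by apply: sd_supp Ec; exact: sing_in_comp.
- case: n c {IH Ec} sc => [|n] c sc; first exact: fsupp0.
  change (fsupp (@small n) (sing_bd (sd c))); rewrite -sd_bd; apply: sd_supp sc; exact: small_comp.
exists (sd_htpy c + e).
  apply: fsuppD => //; apply: sd_htpy_supp Ec => s v; exact: sing_in_comp.
(* By the definition of [sd] this chain is [sd_htpy (sing_bd c)], or zero in degree 0. *)
have step : fsupp (@small n) (c - bd C n (sd_htpy c) - sd c).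
  case: n c {IH Ec e Ee he} sc => [|n] c sc.
    by rewrite subrr; exact: fsupp0.
  rewrite [X in fsupp _ X](_ : _ = sd_htpy (sing_bd c)).
    by apply: sd_htpy_supp sc => s v; exact: small_comp.
  by rewrite /= opprB -(addrA (sing_bd _)) subrKA addrC addrA subrr add0r.
rewrite [iter k.+1 _ _](iterSr k (@sd R Y n)); have := fsuppD step he.
rewrite [X in fsupp _ X -> _](_ : _ = c - bd C n (sd_htpy c + e) - iter k (@sd R Y n) (sd c)) //.
by rewrite -(addrA (sd c)) subrKA addrA raddfD opprD addrA.
Qed.

Lemma sing_excisive (D : set Y) : (forall y, D y <-> A y /\ U y) ->
  excisive (sing_sub A) (sing_sub U) (sing_sub D) (sing_sub E).
Proof.
move=> hD; split.
- by apply: sing_sub_le => y Ay; apply/AUE; left.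
- by apply: sing_sub_le => y Uy; apply/AUE; right.
- move=> n c; split=> [Dc|[/sing_subP Ac /sing_subP Uc]].
    by split; move: Dc; apply: sing_sub_le => y /hD[].
  by apply/sing_subP => s sc t; apply/hD; split; [exact: (Ac s) | exact: (Uc s)].
move=> n c /sing_subP Ec [a [u [/sing_subP Aa /sing_subP Uu] auc]].
have sc : fsupp (@small n.-1) (bdp c).
  rewrite auc; apply: fsuppD; [move: Aa|move: Uu]; apply: fsupp_sub => s h;
    by [left|right].
have [k ksm] := chain_eventually_small Ec.
have [e Ee he] := sd_homotopic k Ec sc.
exists e; first exact/sing_subP.
have := fsuppD he ksm; rewrite subrK => /fsupp_or[a' [b' [Aa' Ub'] ->]].
by exists a', b' => //; split; exact/sing_subP.
Qed.

End Cover.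
End SmallSimplices.

(** * Cones and acyclic spaces *)

Section Augmentation.
Variables (R : realType) (Y : topologicalType).
Local Notation C := (singular_complex R Y).

Definition sing_aug : {additive C 0%N -> int} :=
  (@deg (sing R Y 0) : {additive {freeg (sing R Y 0) / int} -> int}).

Lemma sing_augU (s : sing R Y 0) : sing_aug << s >> = 1.
Proof. exact: degU. Qed.

Lemma sing_aug_bd (c : C 1%N) : sing_aug (bd C 0 c) = 0.
Proof.
apply: (@sing_ext R Y int 1 (fun c => sing_aug (bd C 0 c)) (fun=> 0)) => [x y|x y|s].
- by rewrite !raddfB.
- by rewrite subr0.
rewrite [bd C 0 _]sing_bdU !big_ord_recl big_ord0 addr0 expr0 scale1r expr1.
by rewrite scaleN1r raddfB !sing_augU subrr.
Qed.

End Augmentation.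

Section Cone.
Variable R : realType.
Local Notation Delta n := (@std_simplex R n).

Lemma coord_face n (i : 'I_n.+2) (t : Delta n) j :
  coord (face i t) j = oapp (coord t) 0 (unlift i j).
Proof. by rewrite /coord /= mxE. Qed.

Lemma coord0_face0 n (t : Delta n) : coord (face ord0 t) ord0 = 0.
Proof. by rewrite coord_face unlift_none. Qed.

Lemma coord0_faceS n i (t : Delta n.+1) :
  coord (face (lift ord0 i) t) ord0 = coord t ord0.
Proof.
rewrite coord_face; have -> : ord0 = lift (lift ord0 i) ord0 by apply: val_inj.
by rewrite liftK.
Qed.

Section Project.
Variable n : nat.
Implicit Types t : Delta n.+1.

(* The projection from the vertex 0 to the opposite face (a junk value at that vertex) *)
Definition proj_fun t (j : 'I_n.+1) : R :=
  if coord t ord0 == 1 then (j == ord0)%:R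
  else coord t (lift ord0 j) / (1 - coord t ord0).

Lemma proj_ge0 t j : 0 <= proj_fun t j.
Proof.
rewrite /proj_fun; case: eqP => _; first by rewrite ler0n.
by rewrite divr_ge0 ?coord_ge0 // subr_ge0 coord_le1.
Qed.

Lemma proj_sum t : \sum_j proj_fun t j = 1.
Proof.
rewrite /proj_fun; case: eqVneq => [_|t0].
  by rewrite (bigD1 ord0) //= big1 ?addr0 // => j /negPf ->.
have e : \sum_j coord t (lift ord0 j) = 1 - coord t ord0.
  by rewrite -(coord_sum t) [in RHS]big_ord_recl [RHS]addrC addKr.
by rewrite -mulr_suml e mulfV // subr_eq0 eq_sym.
Qed.

Definition proj t : Delta n := mk_simplex (proj_ge0 t) (proj_sum t).

Lemma coord_proj t j : coord t ord0 != 1 ->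
  coord (proj t) j = coord t (lift ord0 j) / (1 - coord t ord0).
Proof. by move=> /negPf t0; rewrite coord_mk /proj_fun t0. Qed.

Lemma near_coord0 t : coord t ord0 != 1 -> \forall u \near t, coord u ord0 != 1.
Proof.
move=> t0; have := @coord_continuous_simplex R n.+1 ord0 t.
by move/(_ [set x : R | x != 1]%classic); apply; apply: open_nbhs_nbhs; split => //;
   exact: open_neq.
Qed.

Lemma proj_continuous t : coord t ord0 != 1 -> {for t, continuous proj}.
Proof.
move=> t0; apply: simplex_continuous => j.
have cf : {for t, continuous (fun u : Delta n.+1 =>
    coord u (lift ord0 j) / (1 - coord u ord0))}.
  apply: continuousM; first exact: coord_continuous_simplex.
  apply: continuousV; first by rewrite subr_eq0 eq_sym.
  apply: continuousB; first exact: cst_continuous.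
  exact: coord_continuous_simplex.
move=> W; rewrite coord_proj // => /cf.
apply: filterS2 (near_coord0 t0) => u u0 /=.
by rewrite coord_proj.
Qed.

End Project.

Lemma proj_face0 n (t : Delta n) : proj (face ord0 t) = t.
Proof.
have t0 : coord (face ord0 t) ord0 != 1 by rewrite coord0_face0 eq_sym oner_eq0.
by apply: coord_inj => j; rewrite coord_proj // coord0_face0 subr0 divr1 coord_face liftK.
Qed.

Lemma proj_faceS n i (t : Delta n.+1) : coord t ord0 != 1 ->
  proj (face (lift ord0 i) t) = face i (proj t).
Proof.
move=> t0; apply: coord_inj => j; rewrite coord_proj ?coord0_faceS //.
rewrite !coord_face; case: (unliftP i j) => [k|] -> /=.
  have -> : lift ord0 (lift i k) = lift (lift ord0 i) (lift ord0 k) :> 'I_n.+3.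
    by apply: val_inj; rewrite /= /bump /=; lia.
  by rewrite liftK /= coord_proj.
by rewrite unlift_none mul0r.
Qed.

Section ConePoint.
Variables (Y : topologicalType) (B : set Y) (y0 : Y).
Hypotheses (By0 : B y0) (nbhsB : forall O : set Y, open O -> O y0 -> (B `<=` O)%classic).
Local Notation C := (singular_complex R Y).

Definition cone_fun n (s : sing R Y n) (t : Delta n.+1) : Y :=
  if coord t ord0 == 1 then y0 else s (proj t).

(** At the apex there is nothing to estimate: an open set containing [y0] contains all of [B]. An
    open set avoiding [y0] only meets values at points where the coordinate 0 differs from 1, and
    there [proj] is continuous. *)
Lemma cone_continuous n (s : sing R Y n) : sing_in B s -> continuous (cone_fun s).
Proof.
move=> Bs t W; rewrite nbhsE; move=> [V [oV Vt] VW].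
suff : nbhs t (cone_fun s @^-1` V)%classic by apply: filterS => u /VW.
have [Vy0|nVy0] := pselect (V y0).
  apply: filterS (filterT) => u _ /=; apply: nbhsB => //.
  by rewrite /cone_fun; case: eqP.
have t0 : coord t ord0 != 1.
  by apply/negP => t0; apply: nVy0; move: Vt; rewrite /cone_fun t0.
move: Vt; rewrite /cone_fun (negPf t0) => Vt.
have := proj_continuous t0 (@cts_fun _ _ s (proj t) V (open_nbhs_nbhs (conj oV Vt))).
apply: filterS2 (near_coord0 t0) => u /negPf u0 /=.
by rewrite /cone_fun u0.
Qed.

Definition cone n (s : sing R Y n) : sing R Y n.+1 :=
  match pselect (sing_in B s) with
  | left Bs => mkcts (cone_continuous Bs)
  | right _ => cst y0
  end.

Lemma coneE n (s : sing R Y n) t : sing_in B s -> cone s t = cone_fun s t.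
Proof. by rewrite /cone; case: pselect. Qed.

Lemma cone_in n (s : sing R Y n) : sing_in B s -> sing_in B (cone s).
Proof. by move=> Bs t; rewrite coneE // /cone_fun; case: eqP. Qed.

Lemma cone_face0 n (s : sing R Y n) : sing_in B s -> sing_face ord0 (cone s) = s.
Proof.
move=> Bs; apply/continuousEP => t.
rewrite [LHS](_ : _ = cone s (face ord0 t)) // coneE // /cone_fun coord0_face0.
by rewrite eq_sym oner_eq0 proj_face0.
Qed.

Lemma cone_faceS n (s : sing R Y n.+1) i : sing_in B s ->
  sing_face (lift ord0 i) (cone s) = cone (sing_face i s).
Proof.
move=> Bs; apply/continuousEP => t.
rewrite [LHS](_ : _ = cone s (face (lift ord0 i) t)) // !coneE //; last first.
  by move=> u; exact: Bs.
rewrite /cone_fun coord0_faceS; case: eqVneq => // t0.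
by rewrite proj_faceS.
Qed.

(** Omitting vertex 1 leaves the apex; this is the source of the augmentation term in degree 0. *)
Lemma cone_face1 (s : sing R Y 0) : sing_in B s ->
  sing_face (lift ord0 ord0) (cone s) = cst y0 :> sing R Y 0.
Proof.
move=> Bs; apply/continuousEP => t.
rewrite [LHS](_ : _ = cone s (face (lift ord0 ord0) t)) // coneE // /cone_fun.
rewrite coord_face; have -> : ord0 = lift (lift ord0 ord0) ord0 :> 'I_2 by apply: val_inj.
by rewrite liftK /=; have := coord_sum t; rewrite big_ord1 => ->; rewrite eqxx.
Qed.

Definition chain_cone n : C n -> C n.+1 := fglift (fun s : sing R Y n => << cone s >>).

HB.instance Definition _ n :=
  GRing.isZmodMorphism.Build (C n) (C n.+1) (@chain_cone n) (lift_is_additive _).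

Lemma chain_cone_bd n (c : C n.+1) : fsupp (@sing_in R Y B n.+1) c ->
  bd C n.+1 (chain_cone c) = c - chain_cone (bd C n c).
Proof.
apply: (@fglift_ext _ (C n.+1) (fun c => bd C n.+1 (chain_cone c))
  (fun c => c - chain_cone (bd C n c))) => [x y|x y|s Bs].
- by rewrite !raddfB.
- by rewrite !raddfB /= addrACA.
rewrite [chain_cone << s >>]fgliftU [LHS]sing_bdU [bd C n _]sing_bdU.
rewrite big_ord_recl expr0 scale1r cone_face0 //.
rewrite raddf_sum -sumrN; congr (_ + _); apply: eq_bigr => i _ /=.
rewrite cone_faceS // exprS mulN1r scaleNr; congr (- _).
by rewrite -[(-1) ^+ i]intz !scaler_int raddfMz /= /chain_cone fgliftU.
Qed.

Lemma chain_cone_bd0 (c : C 0%N) : fsupp (@sing_in R Y B 0) c ->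
  bd C 0 (chain_cone c) = c - << (cst y0 : sing R Y 0) >> *~ sing_aug R Y c.
Proof.
apply: (@fglift_ext _ (C 0%N) (fun c => bd C 0 (chain_cone c))
  (fun c => c - << (cst y0 : sing R Y 0) >> *~ sing_aug R Y c)) => [x y|x y|s Bs].
- by rewrite !raddfB.
- by rewrite !raddfB /= addrACA.
rewrite [chain_cone << s >>]fgliftU [LHS]sing_bdU sing_augU mulr1z.
rewrite !big_ord_recl big_ord0 addr0 expr0 scale1r cone_face0 // expr1 scaleN1r.
by rewrite cone_face1.
Qed.

(** Coning is a contracting homotopy of the augmented complex. *)
Lemma cone_red_acyclic : red_acyclic (sing_aug R Y) (sing_sub R B).
Proof.
split.
  by exists << (cst y0 : sing R Y 0) >>; [apply/sing_subP; apply/fsuppU | exact: sing_augU].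
move=> n c /sing_subP Bc cyc; exists (chain_cone c).
  by apply/sing_subP; apply: fsupp_lift Bc => s /cone_in Bs; apply/fsuppU.
case: n c Bc cyc => [|n] c Bc cyc; rewrite ?chain_cone_bd0 ?chain_cone_bd //.
  by rewrite [X in _ *~ X]cyc mulr0z subr0.
by rewrite [X in chain_cone X]cyc raddf0 subr0.
Qed.

End ConePoint.
End Cone.

Lemma quot_piB (V : zmodType) (I : zmodClosed V) (x y : V) :
  (\pi_(Quotient.quot I) (x - y) = \pi_(Quotient.quot I) x - \pi_(Quotient.quot I) y)%qT.
Proof. by rewrite !piE. Qed.

(** * From an abstract isomorphism with the homology of a point to reduced acyclicity *)

Section HomologyOfAPoint.
Variables (C D : chain_complex).
Variables (augC : {additive C 0%N -> int}) (augD : {additive D 0%N -> int}).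
Hypotheses (augC_bd : forall c, augC (bd C 0 c) = 0)
           (augD_bd : forall c, augD (bd D 0 c) = 0).

Definition hclass (E : chain_complex) p (c : E p) (c0 : bdp c = 0) : homology E p :=
  \pi_(homology E p)%qT
    (exist _ c (eq_ind_r is_true (introT eqP c0) (cycle_predE c)) : cycles E p).

Lemma hclass_eq (E : chain_complex) p (c c' : E p) c0 c'0 :
  @hclass E p c c0 = @hclass E p c' c'0 <-> exists e, bd E p e = c - c'.
Proof. exact: homology_eqP. Qed.

Lemma hclassP (E : chain_complex) p (h : homology E p) : exists c c0, h = @hclass E p c c0.
Proof.
have c0 : bdp (val (repr h)) = 0 by apply/eqP; rewrite -cycle_predE; exact: valP.
exists (val (repr h)), c0; rewrite -[LHS]reprK; apply/homology_eqP.
by exists 0; rewrite raddf0 subrr.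
Qed.

Definition cycle_class (E : chain_complex) p (z : cycles E p) : homology E p :=
  \pi_(homology E p)%qT z.

Lemma cycle_class_additive (E : chain_complex) p : zmod_morphism (@cycle_class E p).
Proof. exact: quot_piB. Qed.

HB.instance Definition _ (E : chain_complex) p :=
  GRing.isZmodMorphism.Build (cycles E p) (homology E p) (@cycle_class E p)
    (@cycle_class_additive E p).

Lemma hclass0 (E : chain_complex) p (c : E p) c0 : c = 0 -> @hclass E p c c0 = 0.
Proof.
move=> c_eq0; rewrite -(raddf0 (@cycle_class E p)); apply/homology_eqP.
by exists 0; rewrite raddf0 /= c_eq0 subrr.
Qed.

Lemma hclassMz (E : chain_complex) p (c : E p) c0 k ck0 :
  @hclass E p (c *~ k) ck0 = @hclass E p c c0 *~ k.
Proof.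
rewrite -(raddfMz (@cycle_class E p)); apply/homology_eqP; exists 0.
by rewrite raddf0 (raddfMz (val : cycles E p -> E p)) subrr.
Qed.

Hypothesis pointD : red_acyclic augD (full_sub D).
Hypothesis iso : forall p, exists f : {additive homology C p -> homology D p}, bijective f.
Hypothesis nonempty : forall c : C 0%N, c != 0 -> exists d : C 0%N, augC d = 1.

Lemma hclass_pos p (c : C p.+1) c0 : @hclass C p.+1 c c0 = 0.
Proof.
have [f [g fK _]] := iso p.+1; apply: (can_inj fK); rewrite raddf0.
have [d [d0 ->]] := hclassP (f (hclass c0)).
have z0 : bdp (0 : D p.+1) = 0 by rewrite raddf0.
rewrite -(hclass0 z0 erefl); apply/hclass_eq.
have [e _ ed] := pointD.2 p.+1 d isT d0.
by exists e; rewrite subr0.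
Qed.

(** The isomorphism need not respect augmentations. Let [w] represent the preimage of the generator:
    every 0-chain is homologous to a multiple of [w]. Applied to a chain of augmentation 1, this
    shows that [w] has nonzero augmentation, so a 0-chain of augmentation 0 is homologous to the
    zero multiple. *)
Lemma point_red_acyclic : red_acyclic augC (full_sub C).
Proof.
have [f [g fK gK]] := iso 0.
have [u _ u1] := pointD.1.
have z0 : bdp (0 : D 0%N) = 0 by [].
have fE (h : homology C 0) : exists k : int, f h = hclass (erefl : bdp u = 0) *~ k.
  have [d [d0 ->]] := hclassP (f h); exists (augD d).
  have ck0 : bdp (u *~ augD d) = 0 by [].
  rewrite -(hclassMz _ ck0); apply/hclass_eq.
  have [|e _ ed] := pointD.2 0%N (d - u *~ augD d) isT.
    by rewrite /= raddfB raddfMz /= u1 intz subrr.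
  by exists e.
have [w [w0 ew]] := hclassP (g (hclass (erefl : bdp u = 0))).
have gen (c : C 0%N) : exists k : int, exists e, bd C 0 e = c - w *~ k.
  have c0 : bdp c = 0 by [].
  have [k fk] := fE (hclass c0); exists k.
  have wk0 : bdp (w *~ k) = 0 by [].
  apply/(hclass_eq c0 wk0); apply: (can_inj fK).
  by rewrite (hclassMz w0) raddfMz -ew gK.
(* If [w] were zero, the class of [u] would vanish, although [u] has augmentation 1. *)
have [d augd] : exists d : C 0%N, augC d = 1.
  apply: (nonempty (c := w)); apply/eqP => w00.
  have : hclass (erefl : bdp u = 0) = hclass z0.
    by rewrite -[LHS]gK ew (hclass0 w0 w00) raddf0 hclass0.
  move=> /hclass_eq[e /(congr1 augD)].
  by rewrite augD_bd subr0 u1.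
have w1 : augC w != 0.
  have [k [e /(congr1 augC)]] := gen d.
  rewrite augC_bd raddfB raddfMz augd => e1; apply/eqP => w0'.
  by move: e1; rewrite w0' mul0rz subr0.
split; first by exists d.
move=> [|p] c _ cyc.
  have [k [e ee]] := gen c; exists e => //; rewrite ee.
  move: ee => /(congr1 augC); rewrite augC_bd raddfB raddfMz cyc sub0r.
  move/esym/eqP; rewrite oppr_eq0 -mulrzr mulf_eq0 (negPf w1) /= => /eqP.
  by rewrite intz => ->; rewrite subr0.
have z0C : bdp (0 : C p.+1) = 0 by rewrite raddf0.
have := @hclass_pos p c cyc; rewrite -(hclass0 z0C erefl) => /hclass_eq[e].
by rewrite subr0 => ee; exists e.
Qed.

End HomologyOfAPoint.

Section Acyclic.
Variable R : realType.

Lemma acyclic_red_acyclic (Y : topologicalType) : acyclic R Y ->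
  red_acyclic (sing_aug R Y) (full_sub (singular_complex R Y)).
Proof.
move=> acy; apply: (@point_red_acyclic _ _ _ (sing_aug R (discrete_topology unit))) => //.
- exact: sing_aug_bd.
- exact: sing_aug_bd.
(* The one-point space is a cone with apex its point. *)
- have [[d _ d1] h] := @cone_red_acyclic R (discrete_topology unit) setT tt I
    (fun V _ Vt x _ => match x with tt => Vt end).
  split; first by exists d.
  move=> p c _ /h[]; last by move=> e _ <-; exists e.
  by apply/sing_subP => s _ t.
- move=> c; rewrite -dom_eq0; case: (dom c) => // s _ _.
  by exists << s >>; exact: sing_augU.
Qed.

End Acyclic.

(** * Admissible posets *)

Section Embedding.
Variables (R : realType) (Y X : topologicalType) (g : continuousType Y X).
Hypothesis g_inj : injective g.

Lemma ccomp_inj n (s s' : sing R Y n) : ccomp g s = ccomp g s' -> s = s'.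
Proof.
move=> /continuousEP e; apply/continuousEP => t; apply: g_inj; exact: e.
Qed.

Lemma push_inj n (c : sing_chain R Y n) : push g c = 0 -> c = 0.
Proof.
move=> c0; apply/eqP/freeg_eqP => s; rewrite coeff0.
rewrite -(coeff0 int (ccomp g s)) -c0.
apply: (@sing_ext R Y int n (coeff s) (fun c => coeff (ccomp g s) (push g c))).
- by move=> x y; rewrite raddfB.
- by move=> x y; rewrite !raddfB.
move=> s'; rewrite pushU !coeffU; congr (_ * _%:R); congr nat_of_bool.
by apply/eqP/eqP => [->//|/ccomp_inj].
Qed.

Lemma aug_push (c : sing_chain R Y 0) : sing_aug R X (push g c) = sing_aug R Y c.
Proof.
apply: (@sing_ext R Y int 0 (fun c => sing_aug R X (push g c)) (sing_aug R Y)).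
- by move=> x y; rewrite !raddfB.
- by move=> x y; rewrite !raddfB.
by move=> s; rewrite pushU !sing_augU.
Qed.

Variable B : set X.
Hypothesis lift_simplex : forall n (s : sing R X n), sing_in B s ->
  exists s', ccomp g s' = s.
Hypothesis gB : forall y, B (g y).

Lemma push_onto n (c : sing_chain R X n) : fsupp (@sing_in R X B n) c ->
  exists c', push g c' = c.
Proof.
move: c; apply: fsupp_ind => [|c c' [a <-] [a' <-]|s /lift_simplex[s' <-]].
- by exists 0; rewrite raddf0.
- by exists (a - a'); rewrite raddfB.
- by exists << s' >>; rewrite pushU.
Qed.

(** Chains of [X] supported in [B] are push-forwards of chains of [Y], and injectivity of [push g]
    makes the preimage of a cycle a cycle. *)
Lemma push_red_acyclic : red_acyclic (sing_aug R Y) (full_sub (singular_complex R Y)) ->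
  red_acyclic (sing_aug R X) (sing_sub R B).
Proof.
have pushB n (c : sing_chain R Y n) : fsupp (@sing_in R X B n) (push g c).
  apply: (@push_supp R Y X g n (fun=> True)); last exact: fsuppT.
  by move=> s _ t; exact: gB.
move=> [[d _ d1] h]; split.
  by exists (push g d); [apply/sing_subP; exact: pushB | rewrite aug_push].
move=> n c /sing_subP /push_onto[c' <-] cyc.
have [e _ ee] : exists2 e : sing_chain R Y n.+1, True & sing_bd e = c'.
  have [|e _ ee] := h n c' isT; last by exists e.
  case: n c' c cyc => [|n] c' c cyc; first by rewrite /= -aug_push.
  by apply: push_inj; rewrite push_bd.
exists (push g e); first by apply/sing_subP; exact: pushB.
by rewrite -[LHS]push_bd ee.
Qed.

End Embedding.

Section PosetChains.
Variables (R : realType) (d : Order.disp_t) (X : finPOrderType d).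
Local Notation PX := (poset_space X).
Implicit Types (A U D : {set X}) (x y w : X).

Definition poset_incl A : poset_space (subposet A) -> PX := val.

Lemma poset_incl_continuous A : continuous (@poset_incl A).
Proof.
apply/continuousP => V oV; rewrite /open /= => x y yx Vx.
exact: oV yx Vx.
Qed.

Definition pred_set A : set PX := fun x => x \in A.

Lemma poset_incl_lift A n (s : sing R PX n) : sing_in (pred_set A) s ->
  exists s', ccomp (mkcts (@poset_incl_continuous A)) s' = s.
Proof.
move=> sA; pose f t : poset_space (subposet A) := exist _ (s t) (sA t).
have cf : continuous f.
  apply/continuousP => V oV.
  (* The topology of a subposet is the subspace topology: a down-set [V] of [A] is the trace of the
     down-set [W] that it generates in [X]. *)
  pose W : set PX := fun y => exists2 x, V x & (y <= val x)%O.
  have -> : (f @^-1` V = s @^-1` W)%classic.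
    apply/seteqP; split=> t /=; first by exists (f t).
    by move=> [x Vx tx]; apply: oV Vx.
  have oW : open W.
    by move=> x y yx [z Vz xz]; exists z => //; exact: le_trans xz.
  by move/continuousP: (@cts_fun _ _ s); exact.
by exists (mkcts cf); exact/continuousEP.
Qed.

Definition poset_sub A : subcomplex (singular_complex R PX) := sing_sub R (pred_set A).

Lemma acyclic_sub A : acyclic R (poset_space (subposet A)) ->
  red_acyclic (sing_aug R PX) (poset_sub A).
Proof.
move=> /acyclic_red_acyclic; apply: (@push_red_acyclic _ _ _ (mkcts (@poset_incl_continuous A))).
- exact: val_inj.
- exact: poset_incl_lift.
- by move=> y; exact: (valP y).
Qed.

Lemma down_acyclic x : red_acyclic (sing_aug R PX) (poset_sub (down x)).
Proof.
apply: (@cone_red_acyclic R PX _ x); first by rewrite /pred_set inE.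
by move=> V oV Vx y; rewrite /pred_set inE => yx; exact: oV yx Vx.
Qed.

Definition is_down A := forall x y, (y <= x)%O -> x \in A -> y \in A.

Lemma poset_excisive A U : is_down A -> is_down U ->
  excisive (poset_sub A) (poset_sub U) (poset_sub (A :&: U)) (poset_sub (A :|: U)).
Proof.
move=> dA dU; apply: sing_excisive => [|||y].
- by move=> x y; exact: dA.
- by move=> x y; exact: dU.
- by move=> y; rewrite /pred_set inE; split=> [/orP|/orP].
- by rewrite /pred_set inE; split=> [/andP|/andP].
Qed.

Lemma poset_sub_le A U : A \subset U -> forall n (c : singular_complex R PX n),
  c \is_in poset_sub A -> c \is_in poset_sub U.
Proof. by move=> /fintype.subsetP AU; apply: sing_sub_le => y; exact: AU. Qed.

Lemma down_is_down x : is_down (down x).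
Proof. by move=> y z zy; rewrite !inE; exact: le_trans. Qed.

Lemma coversW w x : covers w x -> (w < x)%O.
Proof. by case/andP. Qed.

Lemma covers_max w x y : covers w x -> (w < y)%O -> (y < x)%O -> False.
Proof. by case/andP=> _ /forallP/(_ y) + wy yx; rewrite wy yx. Qed.

Lemma sdownD1_is_down w x : covers w x -> is_down (sdown x :\ w).
Proof.
move=> wx y z zy; rewrite !inE => /andP[yw yx].
rewrite (le_lt_trans zy yx) andbT; apply/eqP => zw.
have : (w < y)%O by rewrite lt_neqAle eq_sym yw -zw.
by move/(covers_max wx)/(_ yx).
Qed.

Definition poset_cell n x :=
  exists z : singular_complex R PX n, rel_cell (poset_sub (sdown x)) (poset_sub (down x)) z.

Lemma poset_cell0 x : sdown x = finset.set0 -> poset_cell 0 x.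
Proof.
move=> x0; apply: (red_acyclic_cell0 (@sing_aug_bd R PX)) (down_acyclic x).
move=> p c /sing_subP; rewrite x0 /fsupp => h; apply/eqP; rewrite -dom_eq0.
case: (dom c) h => // s r h; have := h s (mem_head _ _) (vertex R ord0).
by rewrite /pred_set inE.
Qed.

Hypothesis hX : homologically_admissible X R.

(** The open sets [sdown x :\ w] and [down w] cover [sdown x] and meet in [sdown w]. Excision
    carries the cell of [w] to the pair [(sdown x, sdown x :\ w)], and the acyclic ends of the
    triple with [down x] raise the dimension by one. *)
Lemma poset_cellS n w x : covers w x -> poset_cell n w -> poset_cell n.+1 x.
Proof.
move=> wx [z hz].
have hD := acyclic_sub (hX wx).
have exc := poset_excisive (sdownD1_is_down wx) (@down_is_down w).
have eI : (sdown x :\ w) :&: down w = sdown w.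
  apply/finset.setP => y; rewrite !inE (lt_neqAle y w).
  case: (boolP (y <= w)%O) => [yw|]; rewrite ?andbF // !andbT.
  by rewrite (le_lt_trans yw (coversW wx)) andbT.
have eU : (sdown x :\ w) :|: down w = sdown x.
  apply/finset.setP => y; rewrite !inE; case: (eqVneq y w) => [->|yw] /=.
    by rewrite lexx (coversW wx).
  by case: (boolP (y <= w)%O) => [/le_lt_trans/(_ (coversW wx))->|]; rewrite ?orbF.
rewrite eI eU in exc.
apply: (red_acyclic_cellS (@sing_aug_bd R PX) _ _ hD (down_acyclic x)
  (excision_cell exc hz)).
- by apply: poset_sub_le; rewrite finset.subD1set.
- by apply: poset_sub_le; apply/fintype.subsetP => y; rewrite !inE => /ltW.
Qed.

Lemma poset_cell_uniq n m x : poset_cell n x -> poset_cell m x -> n = m.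
Proof. by move=> [z hz] [y hy]; exact: rel_cell_dim hz hy. Qed.

Lemma covers_exists x y : (y < x)%O -> exists2 w, covers w x & (y <= w)%O.
Proof.
have [n] := ubnP #|[set z | (y < z)%O && (z < x)%O]|.
elim: n y => // n IH y ny yx.
have [/existsP[z /andP[yz zx]]|/existsPn h] := boolP [exists z, (y < z)%O && (z < x)%O].
  have [||w wx zw] := IH z => //.
    move: ny; rewrite ltnS; apply: leq_trans; apply: proper_card; apply/properP; split.
      by apply/fintype.subsetP => u; rewrite !inE => /andP[/(lt_trans yz)->].
    by exists z; rewrite !inE ?yz ?zx // ltxx.
  by exists w => //; apply: le_trans zw; exact: ltW.
by exists y => //; rewrite /covers yx; apply/forallP.
Qed.

Lemma poset_cell_exists x : exists n, poset_cell n x.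
Proof.
have [k] := ubnP #|down x|; elim: k x => // k IH x xk.
have [x0|[y]] := set_0Vmem (sdown x); first by exists 0%N; exact: poset_cell0.
rewrite inE => /covers_exists[w wx _].
have [|n hn] := IH w; last by exists n.+1; exact: poset_cellS hn.
move: xk; rewrite ltnS; apply: leq_trans; apply: proper_card; apply/properP; split.
  by apply/fintype.subsetP => z; rewrite !inE => /le_trans; apply; exact/ltW/coversW.
exists x; rewrite !inE ?lexx //; apply/negP => xw.
by have := le_lt_trans xw (coversW wx); rewrite ltxx.
Qed.

Definition rho x : nat := projT1 (cid (poset_cell_exists x)).

Lemma rhoP x : poset_cell (rho x) x.
Proof. by rewrite /rho; case: cid. Qed.

(** The dimension of the cell of [x] is unique, so it does not depend on the covered element [w]
    from which it is computed. This is where gradedness comes from. *)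
Lemma rho_covers w x : covers w x -> rho x = (rho w).+1.
Proof.
by move=> wx; apply: poset_cell_uniq (rhoP x) (poset_cellS wx (rhoP w)).
Qed.

Lemma rho_lt w x : (w < x)%O -> (rho w < rho x)%N.
Proof.
have [k] := ubnP (rho x); elim: k x => // k IH x xk /covers_exists[y yx wy].
move: wy; rewrite le_eqVlt => /orP[/eqP->|wy]; rewrite (rho_covers yx) //.
by apply: ltnW; rewrite ltnS IH //; move: xk; rewrite (rho_covers yx).
Qed.

Lemma rho_chain x : exists C : {set X}, chain_in (down x) C && (#|C| == (rho x).+1).
Proof.
have [k] := ubnP (rho x); elim: k x => // k IH x xk.
have [x0|[y]] := set_0Vmem (sdown x).
  exists [set x]; rewrite cards1; have -> : rho x = 0%N.
    exact: poset_cell_uniq (rhoP x) (poset_cell0 x0).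
  rewrite eqxx andbT; apply/andP; split; first by rewrite finset.sub1set inE.
  by apply/forall_inP => a /finset.set1P->; apply/forall_inP => b /finset.set1P->; rewrite comparablexx.
rewrite inE => /covers_exists[w wx _]; have [|C /andP[/andP[Cw Cch] /eqP cC]] := IH w.
  by move: xk; rewrite (rho_covers wx).
have Cx z : z \in C -> (z < x)%O.
  by move=> /(fintype.subsetP Cw); rewrite inE => /le_lt_trans; apply; exact: coversW.
have xC : x \notin C by apply/negP => /Cx; rewrite ltxx.
exists (x |: C); rewrite cardsU1 xC cC (rho_covers wx) eqxx andbT.
apply/andP; split.
  apply/fintype.subsetP => z /finset.setU1P[->|/Cx]; rewrite inE ?lexx //; exact: ltW.
apply/forall_inP => a /finset.setU1P[->|aC]; apply/forall_inP => b /finset.setU1P[->|bC].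
- exact: comparablexx.
- by rewrite comparable_sym; apply/orP; left; apply: ltW; exact: Cx.
- by apply/orP; left; apply: ltW; exact: Cx.
- by move/forall_inP: Cch => /(_ a aC)/forall_inP/(_ b bC).
Qed.

(** Along a chain [rho] is injective with values at most [rho x], which bounds every chain;
    descending through covers produces a chain attaining the bound. *)
Lemma degree_rho x : degree x = rho x.
Proof.
apply/eqP; rewrite eqn_leq; apply/andP; split.
  apply/bigmax_leqP => C /maxsetp /andP[/fintype.subsetP Cx /forall_inP Cch].
  have rx z : z \in C -> (rho z < (rho x).+1)%N.
    move=> /Cx; rewrite inE le_eqVlt ltnS => /orP[/eqP->//|/rho_lt/ltnW//].
  pose f z : 'I_(rho x).+1 := inord (rho z).
  have fI : {in C &, injective f}.
    move=> a b aC bC /(congr1 val); rewrite /= !inordK ?rx // => ab.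
    move/forall_inP: (Cch a aC) => /(_ b bC).
    by case: comparableP => // /rho_lt; rewrite ab ltnn.
  have : (#|C| <= (rho x).+1)%N.
    by rewrite -(card_in_imset fI) -[leqRHS]card_ord max_card.
  by case: #|C|.
have [C /andP[Cch /eqP cC]] := rho_chain x.
have [C' mC' CC'] := maxset_exists Cch.
rewrite /degree; apply: leq_trans (leq_bigmax_cond _ mC').
by have := subset_leq_card CC'; rewrite cC; case: #|C'|.
Qed.

Lemma degree_covers w x : covers w x -> degree x = (degree w).+1.
Proof. by move=> wx; rewrite !degree_rho; exact: rho_covers. Qed.

Lemma degree_lt w x : (w < x)%O -> (degree w < degree x)%N.
Proof. by rewrite !degree_rho; exact: rho_lt. Qed.

Lemma presented_critical A x K : is_down A -> x \notin A -> sdown x \subset A ->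
  presented (poset_sub A) K -> presented (poset_sub (x |: A)) K.+1.
Proof.
move=> dA xA xsA; have [z hz] := rhoP x.
have exc := poset_excisive dA (@down_is_down x).
have eI : A :&: down x = sdown x.
  apply/finset.setP => y; rewrite !inE; apply/andP/idP => [[yA]|yx].
    by rewrite le_eqVlt => /orP[/eqP yx|//]; rewrite -yx yA in xA.
  by rewrite ltW // (fintype.subsetP xsA) // inE.
have eU : A :|: down x = x |: A.
  apply/finset.setP => y; rewrite !inE le_eqVlt orbC -orbA; case: eqP => //= _.
  by case: (boolP (y < x)%O) => //= yx; rewrite (fintype.subsetP xsA) // inE.
rewrite eI eU in exc; apply: presented_cell (excision_cell exc hz).
by apply: poset_sub_le; exact: finset.subsetUr.
Qed.

Lemma presented_pair A w x K : is_down A -> covers w x -> w \notin A -> x \notin A ->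
  sdown x :\ w \subset A ->
  presented (poset_sub A) K -> presented (poset_sub ([set w; x] :|: A)) K.
Proof.
move=> dA wx wA xA xsA.
have exc := poset_excisive dA (@down_is_down x).
have eI : A :&: down x = sdown x :\ w.
  apply/finset.setP => y; rewrite !inE; apply/andP/andP => [[yA]|[yw yx]].
    rewrite le_eqVlt => /orP[/eqP yx|->]; first by rewrite -yx yA in xA.
    by split=> //; apply: contraNneq wA => <-.
  by rewrite ltW // (fintype.subsetP xsA) // !inE yw.
have eU : A :|: down x = [set w; x] :|: A.
  apply/finset.setP => y; rewrite !inE le_eqVlt orbC -orbA.
  case: (eqVneq y w) => [->|yw] /=; first by rewrite (coversW wx) !orbT.
  case: eqP => //= _; case: (boolP (y < x)%O) => //= yx.
  by rewrite (fintype.subsetP xsA) // !inE yw.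
rewrite eI eU in exc; apply: presented_acyclic.
  by apply: poset_sub_le; exact: finset.subsetUr.
apply: (excision_acyclic exc); apply: (red_acyclic_rel (@sing_aug_bd R PX) _ (acyclic_sub (hX wx)) (down_acyclic x)).
by apply: poset_sub_le; apply/fintype.subsetP => y; rewrite !inE => /andP[_ /ltW].
Qed.

End PosetChains.

(** * Morse matchings *)

Lemma map_traject (T : Type) (f : T -> T) (x : T) n :
  map f (traject f x n) = traject f (f x) n.
Proof. by elim: n x => //= n IH x; rewrite IH. Qed.

Lemma all2_map (S T U : Type) (r : T -> U -> bool) (g : S -> T) (f : S -> U) s :
  all2 r (map g s) (map f s) = all (fun z => r (g z) (f z)) s.
Proof. by elim: s => //= z s ->. Qed.

Section MatchingTheory.
Variables (R : realType) (d : Order.disp_t) (X : finPOrderType d).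
Hypothesis hX : homologically_admissible X R.
Implicit Types (A L : {set X}) (x y z w : X) (u v : X * X) (c : seq (X * X)).
Variable M : {set X * X}.
Hypothesis hM : is_matching M.

Definition touches x u := (x == u.1) || (x == u.2).

Lemma matching_covers u : u \in M -> covers u.1 u.2.
Proof. by move=> uM; exact: hM.1. Qed.

Lemma matching_eq x u v : u \in M -> v \in M -> touches x u -> touches x v -> u = v.
Proof. by move=> uM vM xu xv; apply: (hM.2 x); rewrite ?inE. Qed.

Lemma matching_neq u v : u \in M -> v \in M -> u.1 <> v.2.
Proof.
move=> uM vM e; have uv : u = v.
  by apply: (@matching_eq u.1); rewrite // /touches ?eqxx // e eqxx orbT.
by have := coversW (matching_covers uM); rewrite e uv ltxx.
Qed.

Lemma criticalPn x : x \notin critical M -> exists2 u, u \in M & touches x u.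
Proof.
rewrite inE => /forall_inPn[u uM]; rewrite negbK !inE => xu.
by exists u.
Qed.

Lemma critical_out x u : x \in critical M -> u \in M -> ~~ touches x u.
Proof. by rewrite inE => /forall_inP h /h; rewrite !inE. Qed.

Definition saturated A := forall u, u \in M -> (u.1 \in A) = (u.2 \in A).

Section Step.
Variables (A : {set X}) (p : nat).
Hypotheses (satA : saturated A) (minp : forall z, z \notin A -> (p <= degree z)%N).

(** Were [z] the upper end of its pair, the lower end would be outside [A] by saturation and of
    smaller degree, against minimality. *)
Lemma matched_up z : z \notin A -> degree z = p -> z \notin critical M ->
  exists2 x, (z, x) \in M & x \notin A.
Proof.
move=> zA zp /criticalPn[[u1 u2] uM /orP[/eqP /= zu|/eqP /= zu]]; subst z.
  by exists u2 => //; rewrite -(satA uM).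
have u1A : u1 \notin A by rewrite (satA uM).
have := degree_lt hX (coversW (matching_covers uM)); rewrite /= zp ltnNge.
by rewrite minp.
Qed.

Lemma sdown_min z : degree z = p -> sdown z \subset A.
Proof.
move=> zp; apply/fintype.subsetP => y; rewrite inE => /(degree_lt hX).
by rewrite zp ltnNge; apply: contraNT => /minp.
Qed.

(** Lying outside [A] forces degree at least [p], lying below [x] forces degree at most [p]; then no
    degree is left for an element strictly between [y] and [x]. *)
Lemma degree_sdown z x y : (z, x) \in M -> degree z = p -> (y < x)%O -> y \notin A ->
  covers y x /\ degree y = p.
Proof.
move=> zxM zp yx yA; have xp : degree x = p.+1.
  by rewrite (degree_covers hX (matching_covers zxM)) zp.
have yp : degree y = p.
  by apply/eqP; rewrite eqn_leq minp // andbT -ltnS -xp (degree_lt hX).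
split=> //; have [w wx] := covers_exists yx.
rewrite le_eqVlt => /orP[/eqP->//|/(degree_lt hX)].
by rewrite yp -ltnS -(degree_covers hX wx) xp ltnn.
Qed.

End Step.

Lemma traject_cycle p (P : X -> Prop) (mate nxt : X -> X) x n :
  (forall z, P z -> [/\ path_step M (z, mate z) (nxt z), degree z = p,
     degree (mate z) = p.+1 & P (nxt z)]) ->
  P x -> iter n.+1 nxt x = x ->
  is_cycle M [seq (z, mate z) | z <- traject nxt x n.+1].
Proof.
move=> step Px xn; rewrite /=; exists p.
have tP k z : z \in traject nxt x k -> P z.
  move=> /trajectP[i _ ->]; elim: i => //= i /step[]//.
rewrite -[(x, mate x) :: _]/[seq (z, mate z) | z <- traject nxt x n.+1].
apply/and4P; split=> //.
- apply/allP => _ /mapP[z /tP/step[_ zp mp _] ->] /=; by rewrite zp mp !eqxx.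
- by have [_ -> _ _] := step _ Px.
rewrite /unzip1 -map_comp map_id_in // [behead _]/=.
have -> : rcons (traject nxt (nxt x) n) x = map nxt (traject nxt x n.+1).
  by rewrite map_traject trajectSr -iterSr xn.
rewrite all2_map; apply/allP => z /tP/step[]//.
Qed.

(** If both fail, every leftover [z] of minimal degree is the lower end of a pair [(z, x)], and
    another leftover [y] of the same degree lies below [x]. Iterating the passage from [z] to [y]
    must loop, as [X] is finite. *)
Lemma morse_step A : morse M -> saturated A -> A != [set: X]%SET ->
  (exists x, [/\ x \notin A, x \in critical M & sdown x \subset A]) \/
  (exists w x, [/\ (w, x) \in M, w \notin A, x \notin A, sdown w \subset A
     & sdown x :\ w \subset A]).
Proof.
move=> mM satA AT.
have [z0 z0A] : exists z, z \notin A.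
  apply/existsP; rewrite -negb_forall; apply: contra AT => /forallP h.
  by apply/eqP/finset.setP => z; rewrite h inE.
pose q := [arg min_(z < z0 | z \notin A) degree z]%N.
have [qA qmin] : q \notin A /\ forall z, z \notin A -> (degree q <= degree z)%N.
  by rewrite /q; case: arg_minnP.
set p := degree q in qmin.
apply: contrapT => /not_orP[ncrit npair].
have /choice[f hf] : forall z, exists yy : X * X, z \notin A /\ degree z = p ->
    [/\ path_step M (z, yy.1) yy.2, degree z = p, degree yy.1 = p.+1 &
     yy.2 \notin A /\ degree yy.2 = p].
  move=> z; have [[zA zp]|nz] := pselect (z \notin A /\ degree z = p); last first.
    by exists (z, z).
  have zs := sdown_min qmin zp.
  have zcr : z \notin critical M.
    by apply/negP => zcr; apply: ncrit; exists z.
  have [x zxM xA] := matched_up satA qmin zA zp zcr.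
  have [y yx [yA yz]] : exists2 y, (y < x)%O & y \notin A /\ y != z.
    apply: contrapT => ny; apply: npair; exists z, x; split=> //.
    apply/fintype.subsetP => y; rewrite !inE => /andP[yz yx].
    by apply: contrapT => /negP yA; apply: ny; exists y.
  have [yxc yp] := degree_sdown qmin zxM zp yx yA.
  exists (x, y) => _; split=> //=.
    by rewrite /path_step zxM /= (matching_covers zxM) yxc eq_sym.
  by rewrite (degree_covers hX (matching_covers zxM)) zp.
pose nxt z := (f z).2; pose mate z := (f z).1.
have Pq : q \notin A /\ degree q = p by [].
have Pn n : iter n nxt q \notin A /\ degree (iter n nxt q) = p.
  by elim: n => //= n /hf[].
(* The trajectory may enter its loop only after [i] steps, so the cycle is started there; its length
   is positive since [i] is below the order. *)
have /trajectP[i iq eq] := looping_order nxt q.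
have [n en] : exists n, fingraph.order nxt q = (n.+1 + i)%N.
  by exists (fingraph.order nxt q - i).-1; rewrite prednK ?subn_gt0 // subnK // ltnW.
rewrite en iterD in eq.
by apply: (mM _ (@traject_cycle p _ mate nxt _ n hf (Pn i) eq)).
Qed.

Lemma is_down_add A x : is_down A -> sdown x \subset A -> is_down (x |: A).
Proof.
move=> dA xsA a b ba; rewrite !inE => /orP[/eqP ax|/(dA _ _ ba)->]; last by rewrite orbT.
move: ba; rewrite ax le_eqVlt => /orP[->//|bx].
by rewrite (fintype.subsetP xsA) ?orbT // inE.
Qed.

Lemma morse_presented : morse M -> presented (full_sub (singular_complex R (poset_space X))) #|critical M|.
Proof.
move=> mM.
(* Induction on the number of elements not yet attached; the generators so far are counted by the
   critical elements in [A]. *)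
suff main n A : (#|~: A|%SET < n)%N -> is_down A -> saturated A ->
    presented (poset_sub R A) #|critical M :&: A| -> presented (poset_sub R [set: X]%SET) #|critical M|.
  have := main #|~: (@finset.set0 X)|.+1 finset.set0 (leqnn _).
  have -> : #|critical M :&: finset.set0| = 0%N by rewrite finset.setI0 cards0.
  move=> h; have {h} : presented (poset_sub R [set: X]%SET) #|critical M|.
    apply: h => [x y|u|]; rewrite ?inE //.
    apply: presented0 => p c /sing_subP; rewrite /fsupp => h; apply/eqP; rewrite -dom_eq0.
    case: (dom c) h => // s r h; have := h s (mem_head _ _) (vertex R ord0).
    by rewrite /pred_set inE.
  apply: presented_acyclic => // p c _ _; exists 0; first by [].
  by apply/sing_subP => s _ t; rewrite /pred_set inE.
elim: n A => // n IH A An dA satA pA.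
have [AT|AT] := eqVneq A [set: X]%SET.
  by move: pA; rewrite AT finset.setIT.
have less A' : A \proper A' -> (#|~: A'|%SET < n)%N.
  move=> AA'; move: An; rewrite ltnS; apply: leq_trans.
  by apply: proper_card; rewrite finset.properC.
case: (morse_step mM satA AT) => [[x [xA xcr xs]]|[w [x [wxM wA xA ws xs]]]].
  apply: (IH (x |: A)).
  - by apply: less; rewrite properEcard finset.subsetUr cardsU1 xA /= add1n.
  - exact: is_down_add.
  - move=> u uM; have := critical_out xcr uM; rewrite !inE /touches negb_or.
    by move=> /andP[/negPf x1 /negPf x2]; rewrite !(eq_sym _ x) x1 x2 satA.
  - have -> : #|critical M :&: (x |: A)| = (#|critical M :&: A|).+1.
      rewrite finset.setIUr (finset.setIidPr _) ?finset.sub1set //.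
      by rewrite cardsU1 !inE (negPf xA) andbF.
    exact: presented_critical.
have wx := matching_covers wxM.
apply: (IH ([set w; x] :|: A)).
- apply: less; apply/properP; split; first exact: finset.subsetUr.
  by exists w => //; rewrite !inE eqxx.
- rewrite -finset.setUA finset.setUCA; apply: is_down_add.
    exact: is_down_add.
  apply/fintype.subsetP => y yx; rewrite !inE; case: eqVneq => //= yw.
  by apply: (fintype.subsetP xs); apply/setD1P.
- move=> u uM; rewrite !inE satA //; congr (_ || _).
  have uwx : touches w u || touches x u -> u = (w, x).
    by case/orP => h; [apply: (@matching_eq w)|apply: (@matching_eq x)];
      rewrite // /touches ?eqxx ?orbT.
  rewrite /touches in uwx.
  apply/idP/idP => h; rewrite uwx /= ?eqxx ?orbT //.
    by case/orP: h => /eqP->; rewrite eqxx ?orbT.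
  by case/orP: h => /eqP->; rewrite eqxx ?orbT.
- have -> : critical M :&: ([set w; x] :|: A) = critical M :&: A.
    apply/finset.setP => y; rewrite finset.inE [in RHS]finset.inE.
    case: (boolP (y \in critical M)) => //= ycr.
    have := critical_out ycr wxM; rewrite /touches /= negb_or => /andP[yw yx].
    by rewrite !finset.inE (negPf yw) (negPf yx).
  exact: presented_pair.
Qed.

End MatchingTheory.

(** * Lower bounds for basic sets *)

Section LowerBounds.
Variables (R : realType) (d : Order.disp_t) (X : finPOrderType d).
Local Notation PX := (poset_space X).
Local Notation C := (singular_complex R PX).
Implicit Types (A : {set X}) (x y : X).

Definition pt x : C 0%N := << (cst (x : PX) : sing R PX 0) >>.

Lemma pt_in A x : x \in A -> pt x \is_in poset_sub R A.
Proof. by move=> xA; apply/sing_subP; apply/fsuppU => t; exact: xA. Qed.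

Lemma pt_aug x : sing_aug R PX (pt x) = 1.
Proof. exact: sing_augU. Qed.

Lemma nonbounding_pt x : nonbounding (pt x).
Proof.
split=> // e /(congr1 (sing_aug R PX)).
by rewrite sing_aug_bd pt_aug.
Qed.

Definition joined A x y :=
  exists2 v : C 1%N, v \is_in poset_sub R A & bd C 0 v = pt x - pt y.

Lemma joined_refl A x : joined A x x.
Proof. by exists 0; rewrite ?subc0 // raddf0 subrr. Qed.

Lemma joined_trans A y x z : joined A x y -> joined A y z -> joined A x z.
Proof.
move=> [v vA ev] [v' v'A ev']; exists (v + v'); first exact: subcD.
by rewrite raddfD /= ev ev' subrKA.
Qed.

Lemma joined_below A x y z : down z \subset A -> (x <= z)%O -> (y <= z)%O -> joined A x y.
Proof.
move=> zA xz yz; have [||v vz ev] := (@down_acyclic R d X z).2 0%N (pt x - pt y).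
- by apply: subcB; apply: pt_in; rewrite inE.
- by rewrite /= raddfB /= !pt_aug subrr.
by exists v => //; exact: poset_sub_le zA _ _ vz.
Qed.

Variables (y0 a b : X).
Hypotheses (y0_max : forall z, ~~ (y0 < z)%O)
  (below_min : forall z y, (z < y0)%O -> ~~ (y < z)%O)
  (ay : (a < y0)%O) (by0 : (b < y0)%O) (ab : a != b).

(** Elements below [y0] are minimal, so [[set a]] and the rest of [sdown y0] are disjoint open sets.
    Splitting a joining chain along them yields a 0-chain supported on the empty set, yet of
    augmentation 1. *)
Lemma not_joined_below : ~ joined (sdown y0) a b.
Proof.
move=> [w wD ew].
have minD z y : (z < y0)%O -> (y <= z)%O -> y = z.
  by move=> zy0; rewrite le_eqVlt (negPf (below_min _ zy0)) orbF => /eqP.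
have da : is_down [set a].
  by move=> x y yx; rewrite !inE => /eqP xa; rewrite (minD a y ay) // -xa.
have dD : is_down (sdown y0 :\ a).
  move=> x y yx; rewrite !inE => /andP[xa xy0].
  by rewrite (minD x y xy0 yx) xa.
have exc := poset_excisive R da dD.
have eU : [set a] :|: (sdown y0 :\ a) = sdown y0.
  by apply/finset.setP => y; rewrite !inE; case: eqVneq => [->|].
have eI : [set a] :&: (sdown y0 :\ a) = finset.set0.
  by apply/finset.setP => y; rewrite !inE; case: eqVneq.
rewrite eU eI in exc; case: exc => _ _ hI sm.
have [|f _ [wa [wr [waA wrD] ef]]] := sm 1%N w wD.
  exists (pt a), (- pt b); last exact: ew.
  split; first by apply: pt_in; rewrite inE.
  by rewrite subcN; apply: pt_in; rewrite !inE eq_sym ab.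
have e : pt a - bd C 0 wa = pt b + bd C 0 wr.
  have /(congr1 (bd C 0)) := ef; rewrite raddfB raddfD /= [bd C 0 (bd C 1 _)]bdK subr0 ew.
  by move=> e; apply/eqP; rewrite subr_eq addrAC -addrA -e addrC subrK.
have : (pt a - bd C 0 wa) \is_in poset_sub R finset.set0.
  apply/hI; split.
    by apply: subcB; [apply: pt_in; rewrite inE | exact: sub_bd].
  rewrite e; apply: subcD; last exact: sub_bd.
  by apply: pt_in; rewrite !inE eq_sym ab.
rewrite e => /sing_subP h.
have : sing_aug R PX (pt a - bd C 0 wa) = 0.
  rewrite e (_ : pt b + _ = 0) ?raddf0 //; apply/eqP; rewrite -dom_eq0.
  move: h; rewrite /fsupp; case: (dom _) => // s r h.
  by have := h s (mem_head _ _) (vertex R ord0); rewrite /pred_set inE.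
by rewrite raddfB /= sing_aug_bd pt_aug subr0.
Qed.

(** A Mayer-Vietoris argument for the open sets [[set: X] :\ y0] and [down y0], which meet in
    [sdown y0]: the loop runs from [a] to [b] through [y0] and back around it, and its connecting
    image is the nonzero class of [a] minus [b]. *)
Lemma nonbounding_loop : joined ([set: X] :\ y0) a b -> exists c : C 1%N, nonbounding c.
Proof.
move=> [v vA ev].
have [u uU eu] : joined (down y0) a b.
  by apply: (@joined_below _ _ _ y0) => //; exact: ltW.
have dA : is_down ([set: X] :\ y0).
  move=> x y yx; rewrite !inE !andbT; apply: contraNneq => e.
  move: yx; rewrite e le_eqVlt (negPf (y0_max x)) orbF => /eqP->//.
have exc := poset_excisive R dA (@down_is_down _ _ y0).
have eI : ([set: X] :\ y0) :&: down y0 = sdown y0.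
  by apply/finset.setP => y; rewrite !inE andbT -lt_neqAle.
have eU : ([set: X] :\ y0) :|: down y0 = [set: X]%SET.
  by apply/finset.setP => y; rewrite !inE andbT; case: eqVneq => //= ->; exact: lexx.
rewrite eI eU in exc; case: exc => _ _ hI sm.
exists (u - v); split=> [|e ee]; first by rewrite /= raddfB /= eu ev subrr.
have eT : e \is_in poset_sub R [set: X]%SET.
  by apply/sing_subP => s _ t; rewrite /pred_set inE.
(* A filling of the loop can be replaced by [a2 + u2]. Then [u - bd C 1 u2 = v + bd C 1 a2] lies in
   both open sets and joins [a] to [b] below [y0]. *)
have [|f _ [a2 [u2 [a2A u2U] ef]]] := sm 2 e eT.
  by exists (- v), u; [rewrite subcN | rewrite [bdp e]ee addrC].
apply: not_joined_below; exists (u - bd C 1 u2); last first.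
  by rewrite raddfB /= [bd C 0 (bd C 1 _)]bdK subr0 eu.
apply/hI; split; last by apply: subcB => //; exact: sub_bd.
have -> : u - bd C 1 u2 = v + bd C 1 a2.
  have /(congr1 (bd C 1)) := ef; rewrite raddfB raddfD /= [bd C 1 (bd C 2 _)]bdK subr0 ee.
  by move=> e'; apply/eqP; rewrite subr_eq addrAC -addrA addrC -subr_eq e' addrC.
by apply: subcD => //; exact: sub_bd.
Qed.

End LowerBounds.

(** * Basic sets that contain a cycle *)

Section BasicSets.
Variables (R : realType) (d : Order.disp_t) (X : finPOrderType d).
Hypothesis hX : homologically_admissible X R.
Implicit Types (A L : {set X}) (x y z w : X) (u v : X * X) (c : seq (X * X)).

Lemma hccat_nonempty L x : x \in L -> (1 <= hccat R (poset_space (subposet L)))%E.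
Proof.
move=> xL; have := @hccat_ge R (singular_complex R (poset_space (subposet L))) [:: 0%N] isT.
apply=> p; rewrite inE => /eqP->.
by exists (pt R (exist _ x xL : subposet L)); exact: nonbounding_pt.
Qed.

Variable M : {set X * X}.
Hypothesis hM : is_matching M.

Lemma all2_path_in s t : all2 (path_step M) s t -> {subset s <= M}.
Proof.
elim: s t => [|u s IH] [|x t] //= /andP[/and4P[uM _ _ _] st] v.
by rewrite inE => /orP[/eqP->//|]; exact: IH st v.
Qed.

Lemma cycleP c : is_cycle M c -> exists p u s,
  [/\ c = u :: s, forall v, v \in c -> degree v.1 = p /\ degree v.2 = p.+1,
      all2 (path_step M) (u :: s) (rcons (unzip1 s) u.1)
    & {subset c <= M}].
Proof.
case: c => // u s [p /and4P[_ /allP deg _ st]]; exists p, u, s; split=> //.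
  by move=> v /deg/andP[/eqP-> /eqP->].
exact: all2_path_in st.
Qed.

Lemma elementsP c x : reflect (exists2 u, u \in c & touches x u) (x \in elements c).
Proof.
rewrite /elements mem_cat; apply: (iffP orP) => [[] /mapP[u uc ->]|[u uc /orP[]/eqP->]].
- by exists u; rewrite // /touches eqxx.
- by exists u; rewrite // /touches eqxx orbT.
- by left; exact: map_f.
- by right; exact: map_f.
Qed.

Section Orbit.
Variables (L : {set X}) (p : nat) (u0 : X * X) (s0 : seq (X * X)).
Hypotheses (cyc : all2 (path_step M) (u0 :: s0) (rcons (unzip1 s0) u0.1))
  (inL : forall u, u \in u0 :: s0 -> u.1 \in L /\ u.2 \in L)
  (degc : forall u, u \in u0 :: s0 -> degree u.1 = p /\ degree u.2 = p.+1)
  (degL : forall z, z \in L -> degree z = p \/ degree z = p.+1).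

Let inM : {subset u0 :: s0 <= M}. Proof. exact: all2_path_in cyc. Qed.
Let u0in : u0 \in u0 :: s0. Proof. exact: mem_head. Qed.
Let y0 : subposet L := exist _ u0.2 (inL u0in).2.
Let e (z : X) : subposet L := insubd y0 z.

Let val_e z : z \in L -> val (e z) = z. Proof. by move=> zL; rewrite insubdK. Qed.

Let y0_max (z : subposet L) : ~~ (y0 < z)%O.
Proof.
apply/negP => yz; have /(degree_lt hX) : (val y0 < val z)%O by rewrite ltEsub in yz.
have [_ ->] := degc u0in.
by case: (degL (valP z)) => ->; rewrite ltnNge ?leqnn ?leqnSn.
Qed.

Let below_min (z y : subposet L) : (z < y0)%O -> ~~ (y < z)%O.
Proof.
move=> zy0; apply/negP => yz.
have /(degree_lt hX) : (val z < val y0)%O by rewrite ltEsub in zy0.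
have /(degree_lt hX) : (val y < val z)%O by rewrite ltEsub in yz.
have [_ ->] := degc u0in.
by case: (degL (valP z)) => ->; case: (degL (valP y)) => ->; lia.
Qed.

(** Both elements lie below [u.2], and [down (e u.2)] avoids [y0]: otherwise [u] and [u0] would
    share their upper end and coincide. *)
Let step_joined u x : u \in u0 :: s0 -> x \in L -> path_step M u x -> u.1 != u0.1 ->
  joined R ([set: subposet L] :\ y0) (e u.1) (e x).
Proof.
move=> uin xL /and4P[uM c1 c2 _] ne; have [u1L u2L] := inL uin.
apply: (@joined_below _ _ _ _ _ _ (e u.2)).
- apply/fintype.subsetP => y; rewrite !inE andbT => yu; apply: contraNneq ne => ey.
  have u2 : u.2 = u0.2.
    rewrite -(val_e u2L); have := yu; rewrite ey le_eqVlt (negPf (y0_max _)) orbF.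
    by move=> /eqP<-.
  have -> : u = u0; last by [].
  by apply: (@matching_eq _ _ _ hM u.2); rewrite ?inM // /touches ?u2 eqxx orbT.
- by rewrite leEsub !val_e // ltW // coversW.
- by rewrite leEsub !val_e // ltW // coversW.
Qed.

(** The cycle is followed only up to the first return to [u0.1], since it may pass through [u0]
    several times. *)
Let path_joined u s : {subset u :: s <= u0 :: s0} ->
  all2 (path_step M) (u :: s) (rcons (unzip1 s) u0.1) ->
  joined R ([set: subposet L] :\ y0) (e u.1) (e u0.1).
Proof.
elim: s u => [|v s IH] u uin; have [->|ne] := eqVneq u.1 u0.1;
  try (move=> _; exact: joined_refl).
  move=> /= /andP[st _]; apply: step_joined => //; first by rewrite uin ?mem_head.
  by have [] := inL u0in.
move=> /= /andP[st rest]; apply: (@joined_trans _ _ _ _ (e v.1)).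
  apply: step_joined => //; first by rewrite uin ?mem_head.
  by have [] := inL (uin v _) => //; rewrite !inE eqxx orbT.
by apply: IH => // w ws; apply: uin; rewrite inE ws orbT.
Qed.

(** The element [y0] has two distinct elements of the cycle below it, [u0.1] and its successor, and
    the remainder of the cycle joins them while avoiding [y0]. Together with the class of a point
    this gives nonbounding cycles in degrees 0 and 1. *)
Lemma hccat_orbit : (2%:R%:E <= hccat R (poset_space (subposet L)))%E.
Proof.
apply: (@hccat_ge R (singular_complex R (poset_space (subposet L))) [:: 0%N; 1%N]) => // q.
rewrite !inE => /orP[]/eqP->.
  by exists (pt R y0); exact: nonbounding_pt.
(* A single pair is no cycle, since consecutive lower elements differ. *)
case: s0 cyc path_joined u0in inL inM => [|v s] cyc' pj u0in' inL' inM'.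
  by move: cyc'; rewrite /= /path_step eqxx !andbF.
move: cyc' => /= /andP[/and4P[u0M c1 c2 ne] rest].
have [v1L v2L] : v.1 \in L /\ v.2 \in L by apply: inL'; rewrite !inE eqxx orbT.
have [u1L _] := inL' _ u0in'.
apply: (@nonbounding_loop _ _ _ y0 (e v.1) (e u0.1)) => //.
- by rewrite ltEsub val_e //= coversW.
- by rewrite ltEsub val_e //= coversW.
- by rewrite -val_eqE /= !val_e // eq_sym.
by apply: (pj v s) => // w ws; rewrite inE ws orbT.
Qed.

End Orbit.
End BasicSets.

(** * Morse-Smale matchings *)

Section MorseSmale.
Variables (R : realType) (d : Order.disp_t) (X : finPOrderType d).
Hypothesis hX : homologically_admissible X R.
Implicit Types (A L : {set X}) (x y z w : X) (u v : X * X) (c : seq (X * X)).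
Variable M : {set X * X}.
Hypothesis hM : is_matching M.

Lemma cycle_degree c : is_cycle M c -> exists p, forall u, u \in c ->
  degree u.1 = p /\ degree u.2 = p.+1.
Proof. by move=> /cycleP[p [u [s [_ deg _ _]]]]; exists p. Qed.

Lemma cycle_sub c : is_cycle M c -> {subset c <= M}.
Proof. by move=> /cycleP[p [u [s []]]]. Qed.

Lemma critical_no_cycle x c : x \in critical M -> is_cycle M c -> x \notin elements c.
Proof.
move=> xcr cyc; apply/elementsP => -[u /(cycle_sub cyc) uM]; apply/negP.
exact: critical_out xcr uM.
Qed.

Lemma elements_in_cycle c u : is_cycle M c -> u \in M -> u.1 \in elements c -> u \in c.
Proof.
move=> cyc uM /elementsP[v vc /orP[/eqP e|/eqP e]]; have vM := cycle_sub cyc vc.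
  suff -> : u = v by [].
  by apply: (@matching_eq _ _ _ hM u.1); rewrite // /touches ?e eqxx.
by have := matching_neq hM uM vM e.
Qed.

Lemma cycle_index_uniq c c' p p' x : is_cycle M c -> is_cycle M c' ->
  (forall u, u \in c -> degree u.1 = p /\ degree u.2 = p.+1) ->
  (forall u, u \in c' -> degree u.1 = p' /\ degree u.2 = p'.+1) ->
  x \in elements c -> x \in elements c' -> p = p'.
Proof.
move=> cyc cyc' dc dc' /elementsP[u uc xu] /elementsP[v vc xv].
have uv : u = v by apply: (matching_eq hM (cycle_sub cyc uc) (cycle_sub cyc' vc) xu xv).
by have [<- _] := dc u uc; have [<- _] := dc' v vc; rewrite uv.
Qed.

(** Concatenation with itself does not change the elements, and a proper root is shorter. The
    disjointness hypothesis, which speaks of prime cycles, thus reaches all cycles. *)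
Lemma prime_root c : is_cycle M c -> exists2 c0, prime_cycle M c0 & elements c0 =i elements c.
Proof.
have [n] := ubnP (size c); elim: n c => // n IH c cn cyc.
have [pc|/not_andP[//|/contrapT[k [c' [k1 cyc' ec]]]]] := pselect (prime_cycle M c).
  by exists c.
have c'0 : (0 < size c')%N by case: c' cyc' {ec}.
have sizec : size c = (k * size c')%N.
  by rewrite ec size_flatten /shape map_nseq sumn_nseq mulnC.
have [|c0 pc0 e0] := IH c' _ cyc'.
  by move: cn; rewrite sizec ltnS; apply: leq_trans; rewrite ltn_Pmull.
exists c0 => // x; rewrite e0.
have mem_c u : (u \in c) = (u \in c').
  rewrite ec; case: k k1 {sizec ec} => // k _; apply/flattenP/idP => [[t]|uc'].
    by rewrite mem_nseq => /andP[_ /eqP->].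
  by exists c' => //; rewrite mem_nseq eqxx.
apply/elementsP/elementsP => -[u uc xu]; exists u => //; [by rewrite mem_c|by rewrite -mem_c].
Qed.

Lemma basic_setsP L : L \in basic_sets M -> exists2 x, x \in chain_recurrent M &
  L = [set y in chain_recurrent M | basic_rel M x y].
Proof. by move=> /imsetP[x xR ->]; exists x. Qed.

Lemma basic_setsI x : x \in chain_recurrent M ->
  [set y in chain_recurrent M | basic_rel M x y] \in basic_sets M.
Proof. by move=> xR; apply/imsetP; exists x. Qed.

Lemma cycle_recurrent c x : is_cycle M c -> x \in elements c -> x \in chain_recurrent M.
Proof.
by move=> cyc xc; rewrite inE; apply/orP; right; apply/asboolP; exists c.
Qed.

Definition chosen_pair L : option (X * X) := [pick u in M | u.1 \in L].

(** What a basic set contributes to the critical elements after the removal: both ends of its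
    removed pair, or all of [L], then a critical singleton. *)
Definition chosen_ends L : {set X} :=
  if chosen_pair L is Some u then [set u.1; u.2] else L.

Lemma basic_rel_sym x y : basic_rel M x y ->
  x = y \/ exists c, [/\ is_cycle M c, x \in elements c & y \in elements c].
Proof. by case/orP=> [/eqP|/asboolP]; [left|right]. Qed.

Lemma chosen_ends_hccat L : L \in basic_sets M ->
  ((#|chosen_ends L|%:R)%:E <= hccat R (poset_space (subposet L)))%E.
Proof.
move=> /basic_setsP[x xR eL].
have xL : x \in L by rewrite eL inE xR /basic_rel eqxx.
have := xR; rewrite [x \in chain_recurrent M]inE => /orP[xcr|/asboolP[c cyc xc]].
  have Lx : L = [set x].
    apply/finset.setP => y; rewrite eL inE finset.in_set1; apply/andP/eqP => [[_]|->].
      case/basic_rel_sym => [->//|[c [cyc xc _]]].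
      by move: (critical_no_cycle xcr cyc); rewrite xc.
    by rewrite xR /basic_rel eqxx.
  have -> : chosen_ends L = L.
    rewrite /chosen_ends /chosen_pair; case: pickP => // u /andP[uM].
    rewrite Lx inE => /eqP ux.
    by have := critical_out xcr uM; rewrite /touches ux eqxx.
  by rewrite {1}Lx cards1; exact: hccat_nonempty xL.
have [p [u0 [s0 [ec deg st _]]]] := cycleP cyc.
have inL z : z \in elements c -> z \in L.
  move=> zc; rewrite eL inE (cycle_recurrent cyc zc) /=; apply/orP; right.
  by apply/asboolP; exists c.
have h2 : (2%:R%:E <= hccat R (poset_space (subposet L)))%E.
  apply: (@hccat_orbit R d X hX M hM L p u0 s0) => //.
  - move=> u; rewrite -ec => uc; split; apply: inL; apply/elementsP; exists u => //;
      by rewrite /touches eqxx ?orbT.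
  - by rewrite -ec.
  (* Every cycle through [x] contains the unique pair of [x], so all of them have the same index. *)
  - have el z c' : is_cycle M c' -> x \in elements c' -> z \in elements c' ->
        degree z = p \/ degree z = p.+1.
      move=> cyc' xc' /elementsP[u uc' zu]; have [p' deg'] := cycle_degree cyc'.
      have -> := cycle_index_uniq cyc cyc' deg deg' xc xc'.
      by have [d1 d2] := deg' u uc'; case/orP: zu => /eqP->; [left|right].
    move=> z; rewrite eL inE => /andP[_ /basic_rel_sym[<-|[c' [cyc' xc' zc']]]].
      exact: (el _ c).
    exact: (el _ c').
apply: le_trans h2; rewrite lee_fin ler_nat /chosen_ends.
case eu: chosen_pair => [u|]; first by rewrite cards2; case: eqP.
have u0c : u0 \in c by rewrite ec mem_head.
move: eu; rewrite /chosen_pair; case: pickP => // /(_ u0).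
rewrite (cycle_sub cyc u0c) inL //; apply/elementsP; exists u0 => //.
by rewrite /touches eqxx.
Qed.

Definition reduced_matching : {set X * X} :=
  [set u in M | [forall L in basic_sets M, chosen_pair L != Some u]].

Lemma reduced_sub : {subset reduced_matching <= M}.
Proof. by move=> u; rewrite inE => /andP[]. Qed.

Lemma reduced_is_matching : is_matching reduced_matching.
Proof.
split=> [u /reduced_sub/hM.1//|x u v /reduced_sub uM /reduced_sub vM].
exact: hM.2.
Qed.

Lemma all2_path_sub (M1 M2 : {set X * X}) s t : {subset M1 <= M2} ->
  all2 (path_step M1) s t -> all2 (path_step M2) s t.
Proof.
move=> sM; elim: s t => [|u s IH] [|x t] //= /andP[/and4P[uM c1 c2 ne] /IH->].
by rewrite /path_step c1 c2 ne sM.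
Qed.

Lemma reduced_cycle c : is_cycle reduced_matching c -> is_cycle M c.
Proof.
case: c => // u s [p /and4P[c0 deg dx st]]; exists p; apply/and4P; split=> //.
exact: all2_path_sub reduced_sub st.
Qed.

Lemma reduced_morse : morse_smale M -> morse reduced_matching.
Proof.
move=> [_ disj] c cyc'; have cyc := reduced_cycle cyc'.
have [p [v [s [ec _ st _]]]] := cycleP cyc'.
have vM' : v \in reduced_matching.
  by apply: (all2_path_in st); rewrite mem_head.
have vM := reduced_sub vM'.
have vc : v.1 \in elements c.
  by apply/elementsP; exists v; rewrite ?ec ?mem_head // /touches eqxx.
have v1R := cycle_recurrent cyc vc.
have Lb := basic_setsI v1R; set L := [set y in _ | _] in Lb.
have v1L : v.1 \in L by rewrite inE v1R /basic_rel eqxx.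
have [u eu] : exists u, chosen_pair L = Some u.
  rewrite /chosen_pair; case: pickP => [u _|/(_ v)]; first by exists u.
  by rewrite vM v1L.
have [uM uL] : u \in M /\ u.1 \in L.
  by move: eu; rewrite /chosen_pair; case: pickP => // u' /andP[u'M u'L] [<-].
have notM' : u \notin reduced_matching.
  rewrite inE uM /=; apply/forall_inPn; exists L => //.
  by rewrite eu eqxx.
have uc : u.1 \in elements c.
  move: uL; rewrite inE => /andP[_ /basic_rel_sym[<-//|[c1 [cyc1 vc1 uc1]]]].
  (* The prime roots of the two cycles share [v.1], so by disjointness they are rotations of each
     other. Hence [c] passes through the removed pair [u], a contradiction. *)
  have [r pr er] := prime_root cyc; have [r1 pr1 er1] := prime_root cyc1.
  have [k ek] : same_orbit r r1.
    by apply: contrapT => /(disj _ _ pr pr1)/(_ v.1); apply; rewrite er er1.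
  rewrite -er; move: uc1; rewrite -er1 ek => /elementsP[w].
  by rewrite mem_rot => wr uw; apply/elementsP; exists w.
have := elements_in_cycle cyc uM uc.
rewrite ec => /(all2_path_in st) uM'.
by move: notM'; rewrite uM'.
Qed.

Lemma card_cover_le (P : {set {set X}}) (F : {set X} -> {set X}) :
  (#|\bigcup_(L in P) F L| <= \sum_(L in P) #|F L|)%N.
Proof.
elim/big_rec2: _ => [|L k B _ IH]; first by rewrite cards0.
by apply: leq_trans (leq_card_setU _ _).1 _; rewrite leq_add2l.
Qed.

(** An element already critical for [M] is accounted for by its own class; any other has lost its
    pair and is an end of the pair chosen in some basic set. *)
Lemma reduced_critical : (#|critical reduced_matching| <= \sum_(L in basic_sets M) #|chosen_ends L|)%N.
Proof.
apply: leq_trans (card_cover_le _ _); apply: subset_leq_card; apply/fintype.subsetP => y ycr.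
have [yc|/(criticalPn)[u uM yu]] := boolP (y \in critical M).
  have yR : y \in chain_recurrent M by rewrite inE yc.
  apply/finset.bigcupP; exists [set z in chain_recurrent M | basic_rel M y z].
    exact: basic_setsI.
  rewrite /chosen_ends /chosen_pair; case: pickP => [u /andP[uM]|_].
    rewrite inE => /andP[_ /basic_rel_sym[yu|[c [cyc yc' _]]]].
      by rewrite !inE yu eqxx.
    by move: (critical_no_cycle yc cyc); rewrite yc'.
  by rewrite inE yR /basic_rel eqxx.
have : u \notin reduced_matching.
  by apply: contraL yu => uM'; exact: critical_out ycr uM'.
rewrite inE uM /= => /forall_inPn[L Lb]; rewrite negbK => /eqP eu.
apply/finset.bigcupP; exists L => //; rewrite /chosen_ends eu !inE.
exact: yu.
Qed.

End MorseSmale.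

Theorem theorem5p2p1 (R : realType) (d : Order.disp_t) (X : finPOrderType d)
    (hX : homologically_admissible X R) :
  (forall M : {set X * X}, is_matching M -> morse_smale M ->
     (hccat R (poset_space X) <=
      \sum_(L in basic_sets M) hccat R (poset_space (subposet L)))%E) /\
  (forall M : {set X * X}, is_matching M -> morse M ->
     (hccat R (poset_space X) <= (#|critical M|%:R)%:E)%E).
Proof.
have main (M : {set X * X}) : is_matching M -> morse M ->
    (hccat R (poset_space X) <= (#|critical M|%:R)%:E)%E.
  by move=> hM mM; apply: presented_hccat; exact: morse_presented.
split=> // M hM msM.
(* The Morse bound is applied to the reduced matching, and its critical elements are distributed
   over the basic sets of [M]. *)
apply: le_trans (main _ (reduced_is_matching hM) (reduced_morse hM msM)) _.
apply: (@le_trans _ _ ((\sum_(L in basic_sets M) #|chosen_ends M L|)%N%:R%:E)).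
  by rewrite lee_fin ler_nat; exact: reduced_critical.
rewrite natr_sum -sumEFin; apply: lee_sum => L Lb.
exact: chosen_ends_hccat.
Qed.
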